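(* Let $G$ be an infinite finitely generated group with a finite symmetric generating set $S$, and let $H$ be a nontrivial finitely generated group. Suppose either (i) $G$ is not virtually-$\mathbb{Z}$ and $H$ is finite, with switch measure $\mu$ uniform on $H$, or (ii) $H$ is infinite, with switch measure $\mu$ a finitely supported, symmetric and non-degenerate probability measure on $H$. Then for every $\lambda\ge1$ the $\lambda$-stationary random walk on $H\wr G$ with switch measure $\mu$ is transient.
   Context: The lamplighter group $H\wr G$ consists of pairs $((L(g))_{g\in G},x)$ with $L:G\to H$ finitely supported and $x\in G$; its identity has all lamps $\mathrm{id}_H$ and $x=\mathrm{id}_G$. The $\lambda$-homesick random walk ($\lambda\ge1$) on $\mathrm{Cay}(G,S)$ (vertices $G$, $g$ adjacent to $gs$, $s\in S$) rooted at $o=\mathrm{id}_G$: $Z_0=o$; at vertex $v$ with neighbors $v_1,\dots,v_j$ at distance $\mathrm{dist}(o,v)-1$ from $o$ and other neighbors $v'_1,\dots,v'_k$, move to each $v_i$ with probability $\frac{\lambda}{\lambda j+k}$ and to each $v'_i$ with probability $\frac{1}{\lambda j+k}$. The $\lambda$-stationary random walk on $H\wr G$ with switch measure $\mu$ is $R_n=((L_n(g))_g,Z_n)$ with $Z_n$ the $\lambda$-homesick walk, $L_0\equiv\mathrm{id}_H$, $(U_n),(V_n)$ i.i.d. $\mu$-distributed independent of $(Z_n)$, and $L_{n+1}(g)=L_n(g)$ for $g\notin\{Z_n,Z_{n+1}\}$, $L_{n+1}(Z_n)=L_n(Z_n)U_{n+1}$, $L_{n+1}(Z_{n+1})=L_n(Z_{n+1})V_{n+1}$.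 Non-degenerate means the support of $\mu$ generates $H$. Transient means $R_n$ returns to the identity only finitely often almost surely. *)

(* Defs.v *)
From HB Require Import structures.
From mathcomp Require Import all_boot all_order all_algebra.
From mathcomp Require Import all_classical all_reals all_analysis.
From mathcomp Require Import monoid.

Set Implicit Arguments.
Unset Strict Implicit.
Unset Printing Implicit Defensive.

Import Order.TTheory GRing.Theory Num.Theory.

Local Open Scope classical_set_scope.
Local Open Scope ring_scope.

Section GroupNotions.
Variable G : groupType.

Definition prodg (s : seq G) : G := foldr (fun x y => (x * y)%g) 1%g s.

Definition generates (A : G -> Prop) : Prop :=
  forall g : G, exists s : seq G,
    (forall x, x \in s -> A x \/ A (x^-1)%g) /\ g = prodg s.

Definition finitely_generated : Prop :=
  exists S : seq G, generates (fun x => x \in S).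

Definition symmetric_set (S : seq G) : Prop :=
  forall s, s \in S -> (s^-1)%g \in S.

Definition finite_group : Prop := exists s : seq G, forall g : G, g \in s.

Definition nontrivial_group : Prop := exists g : G, g != 1%g.

Definition virtually_Z : Prop :=
  exists phi : int -> G,
    injective phi /\ (forall m n : int, phi (m + n) = (phi m * phi n)%g) /\
    exists r : seq G, forall g : G,
      exists2 x, x \in r & exists n : int, g = (x * phi n)%g.

(* Cayley graph Cay(G,S): g adjacent to g*s.  Graph distance from o = 1. *)
Definition is_word (S : seq G) (s : seq G) : bool := all (fun x => x \in S) s.

Definition cay_dist (S : seq G) (v : G) (n : nat) : Prop :=
  (exists s, is_word S s /\ size s = n /\ prodg s = v) /\
  (forall s, is_word S s -> prodg s = v -> (n <= size s)%N).

Definition closer (S : seq G) (v w : G) : Prop :=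
  exists n, cay_dist S w n /\ cay_dist S v n.+1.

Definition nbrs (S : seq G) (v : G) : seq G := undup [seq (v * s)%g | s <- S].

Definition hs_weight (R : realType) (S : seq G) (lam : R) (v w : G) : R :=
  if `[< closer S v w >] then lam else 1.

Definition homesick_p (R : realType) (S : seq G) (lam : R) (v w : G) : R :=
  if w \in nbrs S v then
    hs_weight S lam v w / \sum_(u <- nbrs S v) hs_weight S lam v u
  else 0.

End GroupNotions.

Definition uniform_measure (R : realType) (H : groupType) (mu : H -> R) : Prop :=
  exists s : seq H, uniq s /\ (forall h, h \in s) /\
    forall h, mu h = (size s)%:R^-1.

Definition fin_supp_prob (R : realType) (H : groupType) (mu : H -> R) : Prop :=
  (forall h, 0 <= mu h) /\
  exists s : seq H, uniq s /\ (forall h, h \notin s -> mu h = 0) /\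
    \sum_(h <- s) mu h = 1.

Definition symmetric_measure (R : realType) (H : groupType) (mu : H -> R) : Prop :=
  forall h, mu (h^-1)%g = mu h.

Definition non_degenerate (R : realType) (H : groupType) (mu : H -> R) : Prop :=
  generates (fun h => 0 < mu h).

Definition lamp_update (G H : groupType) (L : G -> H) (x : G) (k : H) : G -> H :=
  fun g => if g == x then (L g * k)%g else L g.

Fixpoint lamps (G H : groupType) (Om : Type) (Z : nat -> Om -> G)
    (U V : nat -> Om -> H) (n : nat) (w : Om) : G -> H :=
  match n with
  | 0 => fun _ => 1%g
  | m.+1 => lamp_update (lamp_update (lamps Z U V m w) (Z m w) (U m.+1 w))
                        (Z m.+1 w) (V m.+1 w)
  end.

(* R_n = ((L_n(g))_g, Z_n) is the identity of H wr G *)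
Definition at_identity (G H : groupType) (Om : Type) (Z : nat -> Om -> G)
    (U V : nat -> Om -> H) (n : nat) (w : Om) : Prop :=
  (forall g, lamps Z U V n w g = 1%g) /\ Z n w = 1%g.

(* The joint law of (Z, U, V): Z is the lambda-homesick walk started at o = 1,
   (U_n)_{n>=1}, (V_n)_{n>=1} i.i.d. mu, all independent of (Z_n).
   Stated through all finite-dimensional distributions. *)
Definition stationary_rw_law (R : realType) (d : measure_display)
    (Om : measurableType d) (P : probability Om R) (G H : groupType)
    (S : seq G) (lam : R) (mu : H -> R)
    (Z : nat -> Om -> G) (U V : nat -> Om -> H) : Prop :=
  (forall n g, measurable [set w | Z n w = g]) /\
  (forall n h, measurable [set w | U n w = h]) /\
  (forall n h, measurable [set w | V n w = h]) /\
  forall (n : nat) (z : seq G) (u v : seq H),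
    size z = n.+1 -> size u = n -> size v = n ->
    P [set w | (forall i, (i <= n)%N -> Z i w = nth 1%g z i) /\
               (forall i, (i < n)%N -> U i.+1 w = nth 1%g u i /\
                                      V i.+1 w = nth 1%g v i)] =
    ((if nth 1%g z 0 == 1%g then 1 else 0) *
     (\prod_(i < n) homesick_p S lam (nth 1%g z i) (nth 1%g z i.+1)) *
     (\prod_(i < n) mu (nth 1%g u i)) *
     (\prod_(i < n) mu (nth 1%g v i)))%:E.

(* Main.v *)
Require Import Defs.
From HB Require Import structures.
From mathcomp Require Import all_boot all_order all_algebra.
From mathcomp Require Import all_classical all_reals all_analysis.
From mathcomp Require Import monoid.
From mathcomp Require Import zify ring lra.

Set Implicit Arguments.
Unset Strict Implicit.
Unset Printing Implicit Defensive.

Import Order.TTheory GRing.Theory Num.Theory.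
Local Open Scope classical_set_scope.
Local Open Scope ring_scope.

(**
A return of the walk to the identity at time n forces Z_n = 1 and every lamp to
be off. Given the trajectory of Z, the lamp at x <> 1 has received 2 N_x
increments, N_x being the number of visits to x, so it is off with probability
a(N_x), where a(j) is the return probability of the mu-walk after 2j steps, and
distinct lamps are independent. Hence the expected number of returns is at most
sum_n E[Z_n = 1; prod_(x in F) a(N_x)] for every finite set F of vertices <> 1.

For a vertex v <> 1 in the ball of radius r, the expected number of visits of Z
to 1 between two consecutive visits to v is at most r kappa^-r, because each
visit to 1 is followed by a visit to v within r steps with probability at least
kappa^r, kappa = 1 / (lam |S|). Therefore sum_n E[Z_n = 1; g(N_v)] is bounded by
r kappa^-r sum_j g(j): neither reversibility nor transience of Z is needed.

If H is infinite, take four vertices: the product is at most the sum of the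
a(N_x)^4, and sum_j a(j)^4 is finite, since the drop a(j) - a(j+1) is a sum of
one-step variances of mu^j, which a Nash-type argument using only the linear
growth of an infinite group bounds below by c a(j)^4.

If H is finite, a(j) = 1/|H| for j > 0. Let F be a large ball without 1. An
unvisited vertex closest to 1, at distance r, contributes at most
|H|^-(|B_(r-1)| - 1) r kappa^-r, and the sum over all vertices converges as soon
as |B_r| / r tends to infinity. This holds unless G is virtually Z: if
|B_r| <= C r infinitely often, infinitely many spheres are bounded, and by
pigeonhole some h shifts a geodesic ray along itself at infinitely many places;
the Busemann function of the ray shows that h has infinite order, and if <h> had
infinite index the balls would grow quadratically.

Borel-Cantelli concludes.
*)

(** * Growth of Cayley balls *)

Section CayleyBalls.
Variables (G : groupType) (S : seq G).
Local Open Scope group_scope.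
Local Open Scope nat_scope.

(** Kept free of duplicates, so that [size] is the cardinality of the ball. *)
Definition cball (n : nat) : seq G :=
  iter n (fun B => undup (B ++ [seq (x * s)%g | x <- B, s <- S])) [:: 1%g].
Arguments cball : simpl never.

Lemma cball_uniq n : uniq (cball n).
Proof. by case: n => [|n] //; exact: undup_uniq. Qed.

Lemma cballSP n (x : G) : reflect
  (x \in cball n \/ exists y s : G, [/\ y \in cball n, s \in S & x = (y * s)%g])
  (x \in cball n.+1).
Proof.
rewrite /cball iterS -/(cball n) mem_undup mem_cat.
apply: (iffP orP) => -[xn|h]; [by left|right|by left|right].
  by have [[y s] /= [yn sS ->]] := allpairsP h; exists y, s.
by have [y [s [yn sS ->]]] := h; apply/allpairsP; exists (y, s).
Qed.

Lemma sub_cballS n x : x \in cball n -> x \in cball n.+1.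
Proof. by move=> xn; apply/cballSP; left. Qed.

Lemma cball_le m n x : m <= n -> x \in cball m -> x \in cball n.
Proof.
move=> /subnKC <-; elim: (n - m) => [|k IH] xm; first by rewrite addn0.
by rewrite addnS; apply: sub_cballS; exact: IH.
Qed.

Lemma mem1_cball n : 1%g \in cball n.
Proof. by apply: (@cball_le 0); rewrite ?inE. Qed.

Lemma cball_step n (x s : G) : x \in cball n -> s \in S -> (x * s)%g \in cball n.+1.
Proof. by move=> xn sS; apply/cballSP; right; exists x, s. Qed.

Lemma cballM m n (x y : G) :
  x \in cball m -> y \in cball n -> (x * y)%g \in cball (m + n).
Proof.
move=> xm; elim: n y => [|n IH] y.
  by rewrite inE => /eqP ->; rewrite mulg1 addn0.
rewrite addnS => /cballSP[/IH/sub_cballS//|[z [s [/IH zn sS ->]]]].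
by rewrite mulgA; exact: cball_step.
Qed.

Lemma cball1 (s : G) : s \in S -> s \in cball 1.
Proof. by move=> sS; rewrite -[s]mul1g; apply: cball_step; rewrite ?inE. Qed.

Lemma cball_word n (x : G) : x \in cball n ->
  exists w, [/\ is_word S w, size w <= n & prodg w = x].
Proof.
elim: n x => [|n IH] x; first by rewrite inE => /eqP ->; exists [::].
move=> /cballSP[/IH[w [wS wn <-]]|[y [s [/IH[w [wS wn <-]] sS ->]]]].
  by exists w; split=> //; exact: ltnW.
exists (rcons w s); split; rewrite ?size_rcons //.
  by rewrite /is_word all_rcons sS.
elim: w {wS wn} => [|t w IHw] /=; first by rewrite mulg1 mul1g.
by rewrite -mulgA IHw.
Qed.

Lemma size_cball n : size (cball n) <= (size S).+1 ^ n.
Proof.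
elim: n => [//|n IH]; rewrite /cball iterS -/(cball n).
apply: leq_trans (size_undup _) _; rewrite size_cat size_allpairs expnS.
by rewrite -mulnS mulnC leq_mul2l IH orbT.
Qed.

Hypothesis Ssym : symmetric_set S.

Lemma cballV n (x : G) : x \in cball n -> x^-1%g \in cball n.
Proof.
elim: n x => [|n IH] x; first by rewrite !inE => /eqP ->; rewrite invg1.
move=> /cballSP[/IH/sub_cballS//|[y [s [/IH yn /Ssym sS ->]]]].
by rewrite invgM -add1n; apply: cballM => //; exact: cball1.
Qed.

Hypothesis Sgen : generates (fun x => x \in S).

Lemma cball_cover (x : G) : exists n, x \in cball n.
Proof.
have [w [wS ->]] := Sgen x; exists (size w).
elim: w wS => [|s w IH] wS /=; first by rewrite inE.
rewrite -add1n; apply: cballM; last first.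
  by apply: IH => y yw; apply: wS; rewrite inE yw orbT.
have [sS|/Ssym] := wS s (mem_head _ _); first exact: cball1.
by rewrite invgK => /cball1.
Qed.

Definition wlen (x : G) := ex_minn (cball_cover x).

Lemma mem_cball (x : G) n : (x \in cball n) = (wlen x <= n).
Proof.
rewrite /wlen; case: ex_minnP => m xm mmin; apply/idP/idP; first exact: mmin.
by move/cball_le; apply.
Qed.

Lemma wlenM (x y : G) : wlen (x * y)%g <= wlen x + wlen y.
Proof. by rewrite -mem_cball; apply: cballM; rewrite mem_cball. Qed.

Lemma wlenV (x : G) : wlen x^-1%g = wlen x.
Proof.
have h y : wlen y^-1%g <= wlen y by rewrite -mem_cball cballV // mem_cball.
by apply/eqP; rewrite eqn_leq h -{1}[x]invgK h.
Qed.

Lemma wlen1 : wlen 1%g = 0.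
Proof. by apply/eqP; rewrite -leqn0 -mem_cball inE. Qed.

Lemma wlen_gen (s : G) : s \in S -> wlen s <= 1.
Proof. by move=> sS; rewrite -mem_cball cball1. Qed.

Lemma wlenX (x : G) n : wlen (x ^+ n)%g <= n * wlen x.
Proof.
elim: n => [|n IH]; first by rewrite expg0 wlen1.
by rewrite expgS mulSn; apply: leq_trans (wlenM _ _) _; rewrite leq_add2l.
Qed.

(** Balls grow by multiplication on the right; passing to the inverse splits off the first letter
    instead of the last. *)
Lemma wlen_consP (x : G) n : wlen x = n.+1 ->
  exists s y : G, [/\ s \in S, x = (s * y)%g & wlen y <= n].
Proof.
move=> xn; have: x^-1%g \in cball n.+1 by rewrite mem_cball wlenV xn.
move=> /cballSP[|[y [s [yn sS xE]]]]; first by rewrite mem_cball wlenV xn ltnn.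
exists s^-1%g, y^-1%g; split; first exact: Ssym.
  by rewrite -invgM -xE invgK.
by rewrite wlenV -mem_cball.
Qed.

End CayleyBalls.
Arguments cball : simpl never.

(** * Finite closed sets versus linear growth *)

Section Growth.
Variables (G : groupType) (A : seq G) (E : G -> G -> Prop).
Hypothesis Erefl : forall x, E x x.
Hypothesis Esym : forall x y, E x y -> E y x.
Local Open Scope nat_scope.

(* Taking [E] to be equality counts the ball, taking [E] to be "same coset"
   counts the cosets that the ball meets. *)
Lemma growth_dichotomy :
  (exists L : seq G, 1%g \in L /\
     forall x s : G, x \in L -> s \in A -> exists2 y, y \in L & E (x * s)%g y) \/
  (forall r, exists L : seq G, [/\ uniq L, size L = r.+1,
     {subset L <= cball A r}, 1%g \in L &
     {in L &, forall x y, E x y -> x = y}]).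
Proof.
have [?|nfin] := pselect (exists L : seq G, 1%g \in L /\
  forall x s : G, x \in L -> s \in A -> exists2 y, y \in L & E (x * s)%g y).
  by left.
right; elim=> [|r [L [uL sL Lr L1 LE]]].
  exists [:: 1%g]; split; rewrite ?inE //.
  by move=> x y; rewrite !inE => /eqP -> /eqP ->.
(* Since [L] is not closed up to [E], some product [x * s] lies in a new class and extends [L]. *)
have [x [s [xL sA h]]] : exists x s : G, [/\ x \in L, s \in A &
    forall y, y \in L -> ~ E (x * s)%g y].
  apply: contrapT => hn; apply: nfin; exists L; split=> // x s xL sA.
  apply: contrapT => hE; apply: hn; exists x, s; split=> // y yL xsy.
  by apply: hE; exists y.
exists ((x * s)%g :: L); split.
- rewrite /= uL andbT; apply/negP => xsL; apply: (h _ xsL); exact: Erefl.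
- by rewrite /= sL.
- move=> y; rewrite inE => /orP[/eqP ->|yL].
    by apply: cball_step => //; apply: Lr.
  by apply: sub_cballS; apply: Lr.
- by rewrite inE L1 orbT.
move=> y z; rewrite !inE => /orP[/eqP ->|yL] /orP[/eqP ->|zL] //.
- by move=> /(h _ zL).
- by move=> /Esym/(h _ yL).
- exact: LE.
Qed.

End Growth.

(** * Geodesic rays and groups of linear growth *)

Section GeodesicRay.
Variables (G : groupType) (S : seq G).
Hypotheses (Ssym : symmetric_set S) (Sgen : generates (fun x => x \in S)).
Hypothesis Ginf : ~ finite_group G.
Local Open Scope group_scope.
Local Open Scope nat_scope.
Local Notation wl := (wlen Ssym Sgen).

Lemma wlen_unbounded n : exists y : G, n <= wl y.
Proof.
apply: contrapT => h; apply: Ginf; exists (cball S n) => g.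
rewrite (mem_cball Ssym Sgen) leqNgt; apply/negP => gn.
by apply: h; exists g; apply: ltnW.
Qed.

(** Vertices with arbitrarily long geodesic continuations, the analogue of an infinite subtree in
    König's lemma. *)
Definition extendable (x : G) :=
  forall n, exists2 y : G, n <= wl y & wl (x * y)%g = wl x + wl y.

(** If every successor had continuations of bounded length, the maximum of these bounds over the
    finite set [S] would bound those of [x]. *)
Lemma extendable_step x : extendable x ->
  exists s : G, [/\ s \in S, wl (x * s)%g = (wl x).+1 & extendable (x * s)%g].
Proof.
move=> xE; apply: contrapT => h.
have step n : exists s : G, [/\ s \in S, wl (x * s)%g = (wl x).+1 &
    exists2 y : G, n <= wl y & wl (x * s * y)%g = wl (x * s)%g + wl y].
  (* Cut off the first letter of a continuation longer than [n]; the triangle inequality makes both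
     pieces geodesic. *)
  have [y ny xy] := xE n.+1.
  case yE: (wl y) => [|m]; first by rewrite yE in ny.
  have [s [z [sS yz zm]]] := wlen_consP yE; exists s.
  have s1 : wl s <= 1 by exact: wlen_gen.
  have xs : wl (x * s)%g <= wl x + wl s by exact: wlenM.
  have sz : wl y <= wl s + wl z by rewrite yz; exact: wlenM.
  have xsz : wl (x * y)%g <= wl (x * s)%g + wl z by rewrite yz mulgA; exact: wlenM.
  split=> //; first lia.
  have xszE : wl (x * s * z)%g = wl (x * y)%g by rewrite yz mulgA.
  by exists z; lia.
have bnd (s : G) : exists N, s \in S -> wl (x * s)%g = (wl x).+1 ->
    forall y : G, wl (x * s * y)%g = wl (x * s)%g + wl y -> wl y < N.
  apply: contrapT => hn; apply: h; exists s.
  have sS : s \in S.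
    by apply: contrapT => nsS; apply: hn; exists 0 => /nsS.
  have xs : wl (x * s)%g = (wl x).+1.
    by apply: contrapT => nxs; apply: hn; exists 0 => _ /nxs.
  split=> // n; apply: contrapT => hy; apply: hn; exists n => _ _ y ye.
  by rewrite ltnNge; apply/negP => ny; apply: hy; exists y.
have [f fP] := choice bnd.
have [s [sS xs [y ny ye]]] := step (\max_(s <- S) f s).
have := fP s sS xs y ye; rewrite ltnNge (leq_trans _ ny) //.
by apply: leq_bigmax_seq.
Qed.

Lemma geodesic_ray : exists ray : nat -> G, ray 0 = 1%g /\
  forall j k, j <= k -> wl ((ray j)^-1 * ray k)%g = k - j.
Proof.
have e1 : extendable 1%g.
  move=> n; have [y ny] := wlen_unbounded n; exists y => //.
  by rewrite mul1g (wlen1 Ssym Sgen).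
have next (x : {x | extendable x}) : exists y : {x | extendable x},
    exists s : G, [/\ s \in S, sval y = (sval x * s)%g &
      wl (sval y) = (wl (sval x)).+1].
  by have [s [sS xs es]] := extendable_step (svalP x); exists (exist _ _ es), s.
have [f fP] := choice next.
pose ray n := sval (iter n f (exist _ _ e1)).
exists ray; split=> // j k jk.
have rl n : wl (ray n) = n.
  elim: n => [|n IH]; first exact: (wlen1 Ssym Sgen).
  by rewrite /ray iterS; have [s [_ _ ->]] := fP (iter n f (exist _ _ e1));
    rewrite -/(ray n) IH.
have ub : forall i, wl ((ray j)^-1 * ray (j + i))%g <= i.
  elim=> [|i IH]; first by rewrite addn0 mulVg (wlen1 Ssym Sgen).
  rewrite addnS /ray iterS.
  have [s [sS -> _]] := fP (iter (j + i) f (exist _ _ e1)).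
  rewrite -/(ray (j + i)) mulgA; apply: leq_trans (wlenM _ _ _ _) _.
  by rewrite -addn1; apply: leq_add => //; exact: wlen_gen.
have lb := wlenM Ssym Sgen (ray j) ((ray j)^-1 * ray k)%g.
rewrite mulVKg !rl in lb.
by have := ub (k - j); rewrite subnKC //; lia.
Qed.

Variable C : nat.
Definition sphere n : seq G := [seq x <- cball S n | wl x == n].

(* A translate of the ray meets the ray, shifted by [t], infinitely often. *)
Lemma shifted_ray (ray : nat -> G) :
  (forall j k, j <= k -> wl ((ray j)^-1 * ray k)%g = k - j) ->
  (forall m, exists2 n, m <= n & size (sphere n) <= C) ->
  exists (h : G) (t : nat), 0 < t /\
    forall m, exists2 n, m <= n & (h * ray n)%g = ray (n + t).
Proof.
move=> rayP Csph; apply: contrapT => hn.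
have bnd (p : nat * nat) : exists N, p.1 < p.2 -> forall i, N <= i ->
    (ray p.2 * (ray p.1)^-1 * ray (p.1 + i) <> ray (p.2 + i))%g.
  apply: contrapT => h; apply: hn.
  have p12 : p.1 < p.2 by rewrite ltnNge; apply/negP => ?; apply: h; exists 0; lia.
  exists (ray p.2 * (ray p.1)^-1)%g, (p.2 - p.1); split; first lia.
  move=> m; apply: contrapT => h'; apply: h; exists m => _ i mi e; apply: h'.
  exists (p.1 + i); first lia.
  by rewrite e; congr ray; lia.
have [f fP] := choice bnd.
(* Beyond [M] no two of the [C + 1] points [g j] below can coincide, yet all lie in a sphere with at
   most [C] elements. *)
pose M := \max_(p : 'I_C.+1 * 'I_C.+1) f (val p.1, val p.2).
have [n Mn sn] := Csph M.
pose g (j : 'I_C.+1) := ((ray j)^-1 * ray (j + n))%g.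
have gin j : g j \in sphere n.
  have gl : wl (g j) = n by rewrite /g rayP ?leq_addr // addKn.
  by rewrite mem_filter gl eqxx (mem_cball Ssym Sgen) gl leqnn.
have ginj : injective g.
  suff key (j k : 'I_C.+1) : g j = g k -> j < k -> False.
    move=> j k e; apply/val_inj.
    by have [/(key _ _ e)|/(key _ _ (esym e))|] := ltngtP (val j) (val k).
  move=> e jk; apply: (fP (val j, val k) jk n).
    by apply: leq_trans Mn; apply: (leq_bigmax (j, k)).
  by rewrite -mulgA -/(g j) e /g mulVKg.
have ug : uniq [seq g j | j <- enum 'I_C.+1] by rewrite map_inj_uniq ?enum_uniq.
have sub : {subset [seq g j | j <- enum 'I_C.+1] <= sphere n}.
  by move=> x /mapP[j _ ->].
by have := uniq_leq_size ug sub; rewrite size_map size_enum_ord ltnNge sn.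
Qed.

(* The increments of the Busemann function of the ray separate the powers. *)
Lemma shift_infinite_order (ray : nat -> G) (h : G) (t : nat) : 0 < t ->
  (forall j k, j <= k -> wl ((ray j)^-1 * ray k)%g = k - j) ->
  (forall m, exists2 n, m <= n & (h * ray n)%g = ray (n + t)) ->
  forall n, (h ^+ n.+1 <> 1)%g.
Proof.
move=> t0 rayP hray.
(* A nonincreasing sequence of naturals is eventually constant. *)
have mono (u : nat -> nat) : (forall m, u m.+1 <= u m) ->
    exists c M, forall m, M <= m -> u m = c.
  move=> um; have [] := @ex_minnP (fun c => `[< exists M, u M <= c >]).
    by exists (u 0); apply/asboolP; exists 0.
  move=> c /asboolP[M Mc] cmin; exists c, M => m Mm.
  apply/eqP; rewrite eqn_leq; apply/andP; split.
    apply: leq_trans Mc; rewrite -(subnKC Mm); elim: (m - M) => [|i IH].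
      by rewrite addn0.
    by rewrite addnS; apply: leq_trans (um _) IH.
  by apply: cmin; apply/asboolP; exists m.
pose D (x y : G) := wl (x^-1 * y)%g.
have Dtri x y z : D x z <= D x y + D y z.
  have := wlenM Ssym Sgen (x^-1 * y)%g (y^-1 * z)%g.
  by rewrite -mulgA mulVKg.
have Dinv g x y : D (g * x)%g (g * y)%g = D x y by rewrite /D invgM -mulgA mulKg.
have Dray j k : j <= k -> D (ray j) (ray k) = k - j by exact: rayP.
clearbody D.
(* The Busemann function: [D x (ray m) - m] is nonincreasing and at least [- D (ray 0) x], so it is
   eventually equal to some [b]. *)
have bus (x : G) : exists b : int, exists M, forall m, M <= m ->
    (D x (ray m))%:Z = (b + m%:Z)%R.
  have lip m : D x (ray m.+1) <= (D x (ray m)).+1.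
    by have := Dtri x (ray m) (ray m.+1); rewrite Dray // subSnn addn1.
  have low m : m <= D x (ray m) + D (ray 0%N) x.
    by have := Dtri (ray 0%N) x (ray m); rewrite Dray // subn0 addnC.
  have [m|c [M cM]] := mono (fun m => D x (ray m) + D (ray 0%N) x - m).
    by have := lip m; have := low m; lia.
  exists (c%:Z - (D (ray 0%N) x)%:Z)%R, M => m Mm.
  by have /= := cM m Mm; have := low m; lia.
have [b bP] := choice bus.
(* At infinitely many [m], [h] carries [ray m] to [ray (m + t)], so translation by [h] lowers [b] by
   [t]. *)
have bh (x : G) : b (h * x)%g = (b x - t%:Z)%R.
  have [M1 h1] := bP x; have [M2 h2] := bP (h * x)%g.
  have [m mM hm] := hray (maxn M1 M2).
  have := h1 m; have := h2 (m + t).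
  by rewrite -hm Dinv; lia.
have bX n : b (h ^+ n)%g = (b 1%g - (n * t)%:Z)%R.
  elim: n => [|n IH]; first by rewrite expg0; lia.
  by rewrite expgS bh IH; lia.
by move=> n e; have := bX n.+1; rewrite e; lia.
Qed.

End GeodesicRay.

(** * The infinite cyclic group generated by an element *)

Section IntegerPowers.
Variables (G : groupType) (h : G).

Definition zpow (n : int) : G :=
  match n with Posz k => (h ^+ k)%g | Negz k => (h ^- k.+1)%g end.

Lemma zpowS n : zpow (n + 1) = (zpow n * h)%g.
Proof.
case: n => [k|[|k]]; rewrite /zpow.
- by rewrite (_ : k%:Z + 1 = k.+1) /=; [rewrite expgSr | lia].
- by rewrite (_ : Negz 0 + 1 = 0%N) /= ?expg1 ?mulVg // NegzE; lia.
- rewrite (_ : Negz k.+1 + 1 = Negz k) /=; last by rewrite !NegzE; lia.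
  by rewrite [(h ^+ k.+2)%g]expgS invgM mulgVK.
Qed.

Lemma zpowD m n : zpow (m + n) = (zpow m * zpow n)%g.
Proof.
elim: n => [|k IH|k IH]; first by rewrite addr0 /= expg0 mulg1.
  by rewrite intS [1 + _]addrC addrA !zpowS IH mulgA.
apply: (mulIg h); rewrite -zpowS -mulgA -zpowS.
have -> : - k.+1%:Z + 1 = - k%:Z :> int by lia.
by rewrite -IH; congr zpow; lia.
Qed.

Hypothesis hinf : forall n, (h ^+ n.+1 <> 1)%g.

Lemma zpow_inj : injective zpow.
Proof.
have key m k : zpow m = zpow (m + k.+1%:Z) -> False.
  rewrite zpowD -{1}[zpow m]mulg1 => /mulgI /esym; exact: hinf.
move=> m n e; have [mn|mn|//] := ltgtP m n.
  have [k kE] : exists k : nat, n = m + k.+1%:Z.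
    by exists (`|n - m|.-1)%N; lia.
  by case: (@key m k); rewrite -kE.
have [k kE] : exists k : nat, m = n + k.+1%:Z.
  by exists (`|m - n|.-1)%N; lia.
by case: (@key n k); rewrite -kE.
Qed.

End IntegerPowers.

(** * Superlinear growth of groups that are not virtually Z *)

Section SuperlinearGrowth.
Variables (G : groupType) (S : seq G).
Hypotheses (Ssym : symmetric_set S) (Sgen : generates (fun x => x \in S)).
Hypothesis Ginf : ~ finite_group G.
Local Open Scope group_scope.
Local Open Scope nat_scope.
Local Notation wl := (wlen Ssym Sgen).

Lemma size_cballS n :
  size (cball S n) + size (sphere Ssym Sgen n.+1) <= size (cball S n.+1).
Proof.
rewrite -size_cat; apply: uniq_leq_size.
  rewrite cat_uniq cball_uniq filter_uniq ?cball_uniq // andbT.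
  apply/hasPn => x; rewrite mem_filter => /andP[/eqP xn _].
  by rewrite (mem_cball Ssym Sgen) xn ltnn.
move=> x; rewrite mem_cat mem_filter => /orP[|/andP[]//].
exact: sub_cballS.
Qed.

(** If all spheres from radius [m] on had more than [C] elements, the balls would grow with slope
    [C + 1], overtaking [C * r] once [r > (C + 1) * m]. *)
Lemma thin_spheres C : (forall r0, exists2 r, r0 <= r & size (cball S r) <= C * r) ->
  forall m, exists2 n, m <= n & size (sphere Ssym Sgen n) <= C.
Proof.
move=> lin m; apply: contrapT => hn.
have big n : m <= n -> C < size (sphere Ssym Sgen n).
  by move=> mn; rewrite ltnNge; apply/negP => ?; apply: hn; exists n.
have lb k : C.+1 * k <= size (cball S (m + k)).
  elim: k => [|k IH]; first by rewrite muln0.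
  rewrite addnS; apply: leq_trans (size_cballS _); rewrite mulnS addnC.
  by apply: leq_add => //; apply: big; lia.
have [r rbig rC] := lin (C.+1 * m).+1.
have := lb (r - m); rewrite subnKC; last by nia.
nia.
Qed.

(** If the cosets [<h> x] were finite in number, [G] would be virtually Z. Otherwise the ball of
    radius [r] meets more than [r] of them, and multiplying representatives by [r] powers of [h]
    gives distinct points. *)
Lemma quadratic_growth (h : G) : (forall n, (h ^+ n.+1 <> 1)%g) ->
  ~ virtually_Z G -> forall r, r * r <= size (cball S (r * (wl h).+1)).
Proof.
move=> hinf nvz r.
pose E (x y : G) := exists n, (zpow h n * x)%g = y.
have E1 x : E x x by exists 0%R; rewrite /= expg0 mul1g.
have Es x y : E x y -> E y x.
  move=> [n <-]; exists (- n)%R.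
  by rewrite mulgA -zpowD addNr /= expg0 mul1g.
have [[L [L1 Lc]]|/(_ r)[L [uL sL Lr _ LE]]] := growth_dichotomy S E1 Es.
  case: nvz; exists (zpow h); split; first exact: zpow_inj.
  split; first exact: zpowD.
  (* Inversion turns the cosets [<h> x] into the cosets [x <h>] of [virtually_Z]. *)
  exists [seq (x^-1)%g | x <- L] => g.
  have cov n x : x \in cball S n -> exists2 y, y \in L & E x y.
    elim: n x => [|n IH] x; first by rewrite inE => /eqP ->; exists 1%g.
    move=> /cballSP[/IH//|[y [s [/IH[z zL [k kz]] sS ->]]]].
    have [w wL [l lw]] := Lc z s zL sS; exists w => //.
    by exists (l + k)%R; rewrite zpowD -lw -kz !mulgA.
  have [n gn] := cball_cover Ssym Sgen g^-1%g.
  have [y yL [k ky]] := cov n _ gn.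
  exists (y^-1)%g; first exact: map_f.
  by exists k; rewrite -ky invgM invgK mulgVK.
have uX : uniq [seq (h ^+ i * x)%g | i <- iota 0 r, x <- L].
  apply: allpairs_uniq; rewrite ?iota_uniq // => -[i x] [j y].
  move=> /allpairsP[[i' x'] /= [_ xL [-> ->]]].
  move=> /allpairsP[[j' y'] /= [_ yL [-> ->]]] /= e.
  have xy : x' = y'.
    apply: LE => //; exists (i'%:Z - j'%:Z)%R.
    rewrite addrC zpowD -mulgA /= e mulgA.
    have -> : zpow h (- j'%:Z)%R = (h ^- j')%g.
      by case: j' {e} => [|k]; [rewrite oppr0 /= expg0 invg1 | rewrite -NegzE].
    by rewrite mulVg mul1g.
  rewrite xy in e *; congr (_, _).
  have /(zpow_inj hinf) [//] : zpow h i'%:Z = zpow h j'%:Z by exact: mulIg e.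
have /(uniq_leq_size uX) : {subset [seq (h ^+ i * x)%g | i <- iota 0 r, x <- L]
    <= cball S (r * (wl h).+1)}.
  move=> z /allpairsP[[i x] /= [+ xL ->]]; rewrite mem_iota => /andP[_ ir].
  rewrite mulnS addnC; apply: cballM; last exact: Lr.
  rewrite (mem_cball Ssym Sgen); apply: leq_trans (wlenX _ _ _ _) _.
  by rewrite leq_mul2r ltnW ?orbT.
by apply: leq_trans; rewrite size_allpairs size_iota sL leq_mul2l leqnSn orbT.
Qed.

Lemma superlinear_growth : ~ virtually_Z G ->
  forall C, exists r0, forall r, r0 <= r -> C * r < size (cball S r).
Proof.
move=> nvz C; apply: contrapT => hn.
have lin r0 : exists2 r, r0 <= r & size (cball S r) <= C * r.
  apply: contrapT => h'; apply: hn; exists r0 => r rr.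
  by rewrite ltnNge; apply/negP => ?; apply: h'; exists r.
have [ray [_ rayP]] := geodesic_ray Ssym Sgen Ginf.
have [h [t [t0 hray]]] := shifted_ray rayP (thin_spheres lin).
have hinf := shift_infinite_order t0 rayP hray.
have quad := quadratic_growth hinf nvz.
set e := (wl h).+1 in quad.
(* The quadratic bound holds at multiples of [e]. For [r = k * e + l] with [l < e] it yields
   [k * k <= C * e * (k + 1)], false once [k > 2 * C * e]. *)
have [r rbig rC] := lin (2 * C * e * e + 2 * e)%N.
have le1 : size (cball S (r %/ e * e)) <= size (cball S r).
  apply: uniq_leq_size (cball_uniq _ _) _ => x.
  by apply: cball_le; exact: leq_trunc_div.
have := leq_trans (quad (r %/ e)) (leq_trans le1 rC).
have re : r %% e < e by rewrite ltn_mod.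
move: (r %/ e) (r %% e) (divn_eq r e) re => k l; clearbody e => rE le kk.
rewrite rE in rbig kk.
have k1 : 2 * (C * e) < k.
  by rewrite ltnNge; apply/negP => hk; have := leq_mul hk (leqnn e); lia.
have : C * (k * e + l) <= (C * e) * k.+1.
  by rewrite -mulnA leq_mul2l mulnS (mulnC e k) addnC leq_add2r ltnW ?orbT.
have := leq_mul k1 (leqnn k); nia.
Qed.

End SuperlinearGrowth.

(** * Decay of convolution powers *)

Section ConvolutionPowers.
Variables (R : realType) (H : groupType) (mu : H -> R) (A : seq H).

(** The law of a product of [n] independent factors, computed by splitting off the last one. *)
Fixpoint convp (n : nat) (x : H) : R :=
  match n with
  | 0%N => (x == 1%g)%:R
  | m.+1 => \sum_(s <- A) mu s * convp m (x * s^-1)%g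
  end.
Arguments convp : simpl never.

Lemma convpS n (x : H) :
  convp n.+1 x = \sum_(s <- A) mu s * convp n (x * s^-1)%g.
Proof. by []. Qed.

Lemma convp0 (x : H) : convp 0 x = (x == 1%g)%:R.
Proof. by []. Qed.

Hypothesis Auniq : uniq A.
Hypothesis Asym : symmetric_set A.
Hypothesis mu_gt0 : forall s, s \in A -> 0 < mu s.
Hypothesis mu_sum : \sum_(s <- A) mu s = 1.
Hypothesis mu_sym : forall s, mu s^-1%g = mu s.

Lemma sum_mu_invg (F : H -> R) :
  \sum_(s <- A) mu s * F s^-1%g = \sum_(s <- A) mu s * F s.
Proof.
have pA : perm_eq A [seq (s^-1)%g | s <- A].
  apply: uniq_perm => //; first by rewrite map_inj_uniq //; exact: invg_inj.
  move=> x; apply/idP/idP => [xA|/mapP[y /Asym yA -> //]].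
  by apply/mapP; exists (x^-1)%g; rewrite ?invgK //; exact: Asym.
rewrite [RHS](perm_big _ pA) big_map /=.
by apply: eq_bigr => s _; rewrite mu_sym.
Qed.

Lemma convpSr n (x : H) :
  convp n.+1 x = \sum_(s <- A) mu s * convp n (x * s)%g.
Proof. by rewrite -(sum_mu_invg (fun s => convp n (x * s)%g)). Qed.

Lemma convp_ge0 n (x : H) : 0 <= convp n x.
Proof.
elim: n x => [|n IH] x; first exact: ler0n.
rewrite convpS big_seq; apply: sumr_ge0 => s sA.
by apply: mulr_ge0 => //; apply: ltW; exact: mu_gt0.
Qed.

Lemma convp_supp n (x : H) : x \notin cball A n -> convp n x = 0.
Proof.
elim: n x => [|n IH] x; first by rewrite inE convp0 => /negPf ->.
move=> xn; rewrite convpS big_seq big1 // => s sA; rewrite IH ?mulr0 //.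
by apply: contra xn => h; rewrite -[x](mulgVK s); exact: cball_step.
Qed.

(** Both sums equal the sum over the whole group, on which right translation is a bijection. *)
Lemma sum_shift (X : seq H) (F : H -> R) (s : H) : uniq X ->
  (forall x : H, x \notin X -> F x = 0) ->
  (forall x : H, x \notin X -> F (x * s)%g = 0) ->
  \sum_(x <- X) F (x * s)%g = \sum_(x <- X) F x.
Proof.
move=> uX F0 Fs0.
have toT (K : H -> R) : (forall x, x \notin X -> K x = 0) ->
    \sum_(x <- X) K x = \sum_(x \in [set: H]) K x.
  move=> K0; rewrite fsbig_seq //; apply: fsbig_widen => // x /= [_ /negP xX].
  exact: K0.
rewrite !toT //; apply/esym/reindex_fsbigT.
by exists (fun x => x * s^-1)%g => x; rewrite ?mulgK ?mulgVK.
Qed.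

Lemma cball_supp m K (x : H) : (m <= K)%N -> x \notin cball A K ->
  convp m x = 0.
Proof. by move=> mK xK; apply: convp_supp; apply: contra xK; exact: (cball_le mK). Qed.

Lemma sum_convp n K : (n <= K)%N -> \sum_(x <- cball A K) convp n x = 1.
Proof.
elim: n => [|n IH] nK.
  rewrite (bigD1_seq 1%g) ?cball_uniq //=; last exact: mem1_cball.
  by rewrite convp0 eqxx big1 ?addr0 // => x /negPf; rewrite convp0 => ->.
under eq_bigr do rewrite convpS.
rewrite exchange_big /= -mu_sum; apply: eq_big_seq => s sA.
rewrite -mulr_sumr -[RHS]mulr1; congr (_ * _); rewrite -{}IH; last exact: ltnW.
apply: (@sum_shift _ (convp n)); first exact: cball_uniq.
  by move=> x; apply: cball_supp; exact: ltnW.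
move=> x xK; apply: convp_supp; apply: contra xK => h.
apply: (cball_le nK); rewrite -[x](mulgVK s); exact: cball_step.
Qed.

(** By symmetry of [mu], factors move one at a time from the second convolution power to the first,
    until the second is the Dirac mass at 1. *)
Lemma convp_inner m n K : (m + n <= K)%N ->
  \sum_(x <- cball A K) convp m x * convp n x = convp (m + n) 1%g.
Proof.
elim: n m => [|n IH] m mnK.
  rewrite (bigD1_seq 1%g) ?cball_uniq //=; last exact: mem1_cball.
  rewrite convp0 eqxx mulr1 addn0 big1 ?addr0 // => x /negPf.
  by rewrite convp0 => ->; exact: mulr0.
rewrite addnS -addSn -IH; last by rewrite addSn -addnS.
under eq_bigr do rewrite convpS mulr_sumr.
under [RHS]eq_bigr do rewrite convpSr mulr_suml.
rewrite exchange_big [RHS]exchange_big /=; apply: eq_big_seq => s sA.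
under eq_bigr do rewrite mulrCA.
under [RHS]eq_bigr do rewrite -mulrA.
rewrite -!mulr_sumr; congr (_ * _).
rewrite -(@sum_shift _ (fun x => convp m (x * s)%g * convp n x) (s^-1)%g) //.
- by apply: eq_bigr => x _; rewrite mulgVK.
- exact: cball_uniq.
- by move=> x xK; rewrite (@cball_supp n K) ?mulr0 //; lia.
by move=> x xK; rewrite mulgVK (@cball_supp m K) ?mul0r //; lia.
Qed.

(** Even times only, because every visit to a vertex contributes two increments to its lamp. *)
Definition returnp n : R := convp n.*2 1%g.

Lemma returnp_sum n K : (n.*2 <= K)%N ->
  returnp n = \sum_(x <- cball A K) convp n x ^+ 2.
Proof. by rewrite /returnp -addnn => nK; rewrite -(convp_inner nK). Qed.

(** The variance of [convp n] over one step from [x]; by symmetry the mean is [convp n.+1 x]. *)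
Let stepvar n (x : H) : R :=
  \sum_(s <- A) mu s * (convp n (x * s)%g - convp n.+1 x) ^+ 2.

Lemma stepvarE n (x : H) : stepvar n x =
  \sum_(s <- A) mu s * convp n (x * s)%g ^+ 2 - convp n.+1 x ^+ 2.
Proof.
rewrite /stepvar; set m := convp n.+1 x.
transitivity (\sum_(s <- A) (mu s * convp n (x * s)%g ^+ 2
   - 2 * m * (mu s * convp n (x * s)%g) + m ^+ 2 * mu s)).
  by apply: eq_bigr => s _; ring.
rewrite big_split sumrB /= -!mulr_sumr mu_sum -convpSr -/m; ring.
Qed.

(** In the variance formula the second moments sum to [returnp n] by translation invariance, and the
    squared means sum to [returnp n.+1]. *)
Lemma returnp_drop n : returnp n - returnp n.+1 =
  \sum_(x <- cball A n.+1.*2) stepvar n x.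
Proof.
under eq_bigr do rewrite stepvarE.
rewrite sumrB -returnp_sum //; congr (_ - _).
rewrite exchange_big /= -[LHS]mul1r -mu_sum mulr_suml.
apply: eq_big_seq => s sA; rewrite -mulr_sumr; congr (_ * _).
rewrite (@sum_shift _ (fun x => convp n x ^+ 2)) ?cball_uniq //.
- by rewrite (@returnp_sum n n.+1.*2) // leq_double.
- by move=> x xK; rewrite (cball_supp _ xK) ?expr0n //; lia.
move=> x xK; rewrite (@convp_supp n) ?expr0n //; apply: contra xK => h.
apply: (@cball_le _ _ n.+1); first lia.
by rewrite -[x](mulgK s); apply: cball_step => //; exact: Asym.
Qed.

Lemma mu_lower_bound : exists2 k : R, 0 < k & forall s, s \in A -> k <= mu s.
Proof.
elim: A mu_gt0 => [|s B IH] pos; first by exists 1.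
have [|k k0 kB] := IH; first by move=> t tB; apply: pos; rewrite inE tB orbT.
have s0 : 0 < mu s by apply: pos; exact: mem_head.
exists (Num.min k (mu s)); first by rewrite lt_min k0.
move=> t; rewrite inE => /orP[/eqP ->|/kB kt]; first by rewrite ge_min lexx orbT.
by rewrite ge_min kt.
Qed.

Hypothesis Agen : generates (fun x => x \in A).
Hypothesis Hinf : ~ finite_group H.

(** Points differing by a step in [Q] are neighbours [z * s] and [z * t] of a common [z], the kind
    of pair that [stepvar] compares. *)
Let Q : seq H := [seq (s^-1 * t)%g | s <- A, t <- A].

(** Products of an even number of letters form a subgroup of index at most two: a finite set closed
    under [Q], together with its translate by [s0], would exhaust [H]. *)
Lemma even_growth r : exists L : seq H,
  [/\ uniq L, size L = r.+1 & {subset L <= cball Q r}].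
Proof.
have [[L [L1 Lc]]|] := @growth_dichotomy H Q eq (fun=> erefl) (fun _ _ => @esym _ _ _).
  have [s0 s0A] : exists s, s \in A.
    case: (A) mu_sum => [|s B] e; last by exists s; exact: mem_head.
    by move: e; rewrite big_nil => /esym/eqP; rewrite oner_eq0.
  case: Hinf; exists (L ++ [seq (x * s0)%g | x <- L]) => g.
  have [n] := cball_cover Asym Agen g.
  elim: n g => [|n IH] g; first by rewrite inE mem_cat => /eqP ->; rewrite L1.
  move=> /cballSP[/IH//|[y [s [/IH + sA ->]]]].
  rewrite !mem_cat => /orP[yL|/mapP[x xL ->]]; apply/orP; [right|left].
    have [|z zL ze] := Lc y ((s^-1)^-1 * s0^-1)%g yL.
      by apply/allpairsP; exists ((s^-1)%g, (s0^-1)%g); split=> //; exact: Asym.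
    by apply/mapP; exists z => //; rewrite -ze invgK mulgA mulgVK.
  have [|z zL ze] := Lc x ((s0^-1)^-1 * s)%g xL.
    by apply/allpairsP; exists ((s0^-1)%g, s); split=> //; exact: Asym.
  by rewrite -mulgA -{1}[s0]invgK ze.
by move=> /(_ r)[L [uL sL Lr _ _]]; exists L.
Qed.

(* The convolution power [f] is at most [M/2] somewhere within [O(1/M)] steps of
   a maximum [M], so some single step changes it by at least [c M^2]. *)
Lemma returnp_drop_ge : exists2 c : R, 0 < c &
  forall n, c * returnp n ^+ 4 <= returnp n - returnp n.+1.
Proof.
have [kap kap0 kapP] := mu_lower_bound.
(* 144 is 36 times 4: a jump of [M ^+ 2 / 6] has square [M ^+ 4 / 36], and by the parallelogram law
   [kap] times the squared jump is at most four times the variance. *)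
exists (kap / 144%:R); first by rewrite divr_gt0.
move=> n; set a := returnp n; pose f := convp n; pose X := cball A n.+1.*2.
have f0 x : 0 <= f x by exact: convp_ge0.
have supp (x : H) : x \notin cball A n -> f x = 0 by exact: convp_supp.
have nX x : x \in cball A n.+1 -> x \in X by apply: cball_le; lia.
have sumf : \sum_(x <- X) f x = 1 by apply: sum_convp; lia.
have [x0 x0max] : exists x0, forall x, f x <= f x0.
  have mx (L : seq H) y : exists x0, forall x, x \in y :: L -> f x <= f x0.
    elim: L => [|w L [x0 IH]].
      by exists y => x; rewrite inE => /eqP ->.
    have [le|lt] := leP (f w) (f x0).
      exists x0 => x; rewrite !inE => /or3P[/eqP ->|/eqP -> //|xL].
        by apply: IH; exact: mem_head.
      by apply: IH; rewrite inE xL orbT.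
    exists w => x; rewrite !inE => /or3P[/eqP ->|/eqP -> //|xL].
      by apply: le_trans (ltW lt); apply: IH; exact: mem_head.
    by apply: le_trans (ltW lt); apply: IH; rewrite inE xL orbT.
  have [x0 hx0] := mx (cball A n) 1%g; exists x0 => x.
  have [xn|/supp ->] := boolP (x \in cball A n); last exact: f0.
  by apply: hx0; rewrite inE xn orbT.
set M := f x0.
have sumL (L : seq H) : uniq L -> \sum_(x <- L) f x <= 1.
  move=> uL; rewrite -sumf (bigID (mem X)) [leRHS](bigID (mem L)) /=.
  rewrite [X in _ + X]big1 ?addr0; last first.
    by move=> x xX; apply: supp; apply: contra xX => ?; apply/nX/sub_cballS.
  rewrite -big_filter -[in leRHS]big_filter (perm_big [seq x <- X | x \in L]) /=.
    by rewrite lerDl sumr_ge0.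
  apply: uniq_perm; rewrite ?filter_uniq ?cball_uniq // => x.
  by rewrite !mem_filter andbC.
have M1 : M <= 1 by have := sumL [:: x0] isT; rewrite big_seq1.
have aE : a = \sum_(x <- X) f x ^+ 2 by apply: returnp_sum; lia.
have a0 : 0 <= a by rewrite aE sumr_ge0 // => x _; exact: sqr_ge0.
have aM : a <= M.
  rewrite aE -[leRHS]mulr1 -sumf mulr_sumr ler_sum // => x _.
  by rewrite expr2 ler_wpM2r.
have M0 : 0 < M.
  rewrite lt_neqAle f0 andbT; apply/negP => /eqP M0.
  have := oner_neq0 R; rewrite -sumf big1 ?eqxx // => x _.
  by apply/eqP; rewrite eq_le f0 andbT M0 x0max.
(* With [k > 2 / M], more than [k] points of value at least [M / 2] would carry mass above 1. With
   [k <= 3 / M], a descent of [M / 2] in [k] steps has a step of at least [M ^+ 2 / 6]. *)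
have [k kM kM3] : exists2 k : nat, 2 / M < k%:R & k%:R <= 3 / M.
  exists (Num.truncn (2 / M)).+1; first exact: truncnS_gt.
  have : (Num.truncn (2 / M))%:R <= 2 / M by rewrite truncn_le // divr_ge0 // ltW.
  have : 1 <= 1 / M by rewrite ler_pdivlMr // mul1r.
  by rewrite -[in X in _ -> _ -> X]natr1; lra.
have [y yk fy] : exists2 y : H, y \in cball Q k & f (x0 * y)%g < M / 2.
  apply: contrapT => hn; have [L [uL sL Lk]] := even_growth k.
  have u' : uniq [seq (x0 * y)%g | y <- L] by rewrite map_inj_uniq //; exact: mulgI.
  have := sumL _ u'; rewrite big_map leNgt => /negP; apply.
  apply: (@lt_le_trans _ _ (\sum_(y <- L) (M / 2))).
    rewrite big_const_seq count_predT sL iter_addr_0 mulrSr -mulr_natr.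
    move: kM; rewrite ltr_pdivrMr // => kM; nra.
  rewrite big_seq [leRHS]big_seq ler_sum // => y yL.
  by rewrite leNgt; apply/negP => hy; apply: hn; exists y => //; apply: Lk.
have [z [s [t [sA tA jump]]]] : exists z s t : H, [/\ s \in A, t \in A &
    M ^+ 2 / 6%:R < `|f (z * s)%g - f (z * t)%g|].
  apply: contrapT => hn.
  have slow z s t : s \in A -> t \in A ->
      `|f (z * s)%g - f (z * t)%g| <= M ^+ 2 / 6%:R.
    by move=> sA tA; rewrite leNgt; apply/negP => hz; apply: hn; exists z, s, t.
  have dec j w : w \in cball Q j -> M - f (x0 * w)%g <= j%:R * (M ^+ 2 / 6%:R).
    elim: j w => [|j IH] w.
      by rewrite inE => /eqP ->; rewrite mulg1 subrr mul0r.
    have d0 : 0 <= M ^+ 2 / 6%:R by rewrite divr_ge0 // sqr_ge0.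
    rewrite mulr_natl mulrSr -mulr_natl => /cballSP[/IH h|]; first by lra.
    move=> [v [q [/IH h /allpairsP[[s t] /= [sA tA ->]] ->]]].
    have := slow (x0 * v * s^-1)%g s t sA tA; rewrite mulgVK -!mulgA.
    move=> /ler_normlP[_]; lra.
  have := dec k y yk.
  have : k%:R * (M ^+ 2 / 6%:R) <= M / 2.
    move: kM3; rewrite ler_pdivlMr // => kM3; nra.
  lra.
have zX : z \in X.
  apply/nX; apply: contrapT => /negP zn; move: jump; rewrite !supp.
  - by rewrite subrr normr0 ltNge divr_ge0 // sqr_ge0.
  - by apply: contra zn => h; rewrite -[z](mulgK t) cball_step // Asym.
  by apply: contra zn => h; rewrite -[z](mulgK s) cball_step // Asym.
rewrite returnp_drop (bigD1_seq z) ?cball_uniq //=.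
have term0 x r : r \in A -> 0 <= mu r * (convp n (x * r)%g - convp n.+1 x) ^+ 2.
  by move=> rA; rewrite mulr_ge0 ?sqr_ge0 // ltW // mu_gt0.
have var0 x : 0 <= stepvar n x.
  by rewrite /stepvar big_seq sumr_ge0 // => r; exact: term0.
apply: ler_wpDr; first by apply: sumr_ge0.
have varz r : r \in A -> kap * (f (z * r)%g - convp n.+1 z) ^+ 2 <= stepvar n z.
  move=> rA; rewrite /stepvar (bigD1_seq r) //= -/f.
  apply: ler_wpDr.
    by rewrite big_seq_cond sumr_ge0 // => q /andP[qA _]; exact: term0.
  by rewrite ler_wpM2r ?sqr_ge0 // kapP.
have := varz s sA; have := varz t tA.
set m := convp n.+1 z; set V := stepvar n z.
move: jump; set u := f _; set v := f _ => jump vt vs.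
have a4 : a ^+ 4 <= M ^+ 4 by rewrite lerXn2r // nnegrE // ltW.
have d4 : M ^+ 4 / 36%:R <= (u - v) ^+ 2.
  have -> : M ^+ 4 / 36%:R = (M ^+ 2 / 6%:R) ^+ 2 by field.
  rewrite -(real_normK (num_real (u - v))) lerXn2r ?nnegrE ?normr_ge0 ?(ltW jump) //.
  by rewrite divr_ge0 // sqr_ge0.
have uv : kap * (u - v) ^+ 2 <= 4 * V.
  have : 0 <= kap * (u + v - 2 * m) ^+ 2 by rewrite mulr_ge0 ?sqr_ge0 // ltW.
  lra.
have : kap * a ^+ 4 <= kap * M ^+ 4 by rewrite ler_pM2l.
have : kap * (M ^+ 4 / 36%:R) <= kap * (u - v) ^+ 2 by rewrite ler_pM2l.
lra.
Qed.

(** The lower bounds on the drops telescope, starting from [returnp 0 = 1]. *)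
Lemma sum_returnp4 : exists C : R, forall N,
  \sum_(n < N) returnp n ^+ 4 <= C.
Proof.
have [c c0 cP] := returnp_drop_ge; exists c^-1 => N.
have tele : c * \sum_(n < N) returnp n ^+ 4 <= returnp 0 - returnp N.
  elim: N => [|N IH]; first by rewrite big_ord0 mulr0 subrr.
  rewrite big_ord_recr mulrDr /=.
  by apply: le_trans (lerD IH (cP N)) _; rewrite addrA subrK.
rewrite -(ler_pM2l c0) mulfV ?gt_eqF //; apply: le_trans tele _.
rewrite {1}/returnp convp0 eqxx lerBlDr lerDl; exact: convp_ge0.
Qed.

End ConvolutionPowers.
Arguments convp : simpl never.

(** * Visits of the homesick walk *)

Section HomesickWalk.
Variables (R : realType) (G : groupType) (S : seq G) (lam : R).
Hypothesis lam1 : 1 <= lam.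
Hypothesis S0 : S != [::].

Definition stepp (x s : G) : R := homesick_p S lam x (x * s)%g.

Lemma nbrsE (x : G) : nbrs S x = [seq (x * s)%g | s <- undup S].
Proof. by rewrite /nbrs undup_map_inj //; exact: mulgI. Qed.

Lemma hs_weight_bounds (x y : G) : 1 <= hs_weight S lam x y <= lam.
Proof. by rewrite /hs_weight; case: ifP => _; rewrite lexx ?lam1. Qed.

Lemma hs_weight_sum_gt0 (x : G) : 0 < \sum_(u <- nbrs S x) hs_weight S lam x u.
Proof.
have [s sS] : exists s, s \in S.
  by case: (S) S0 => [//|s S'] _; exists s; exact: mem_head.
rewrite (bigD1_seq (x * s)%g) ?undup_uniq //=; last by rewrite mem_undup map_f.
apply: ltr_pwDl; first by have /andP[+ _] := hs_weight_bounds x (x * s)%g; lra.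
by apply: sumr_ge0 => u _; have /andP[+ _] := hs_weight_bounds x u; lra.
Qed.

Lemma stepp_ge0 (x s : G) : 0 <= stepp x s.
Proof.
rewrite /stepp /homesick_p; case: ifP => // _; apply: divr_ge0.
  by have /andP[+ _] := hs_weight_bounds x (x * s)%g; lra.
by apply: sumr_ge0 => u _; have /andP[+ _] := hs_weight_bounds x u; lra.
Qed.

Lemma steppE (x s : G) : s \in S -> stepp x s =
  hs_weight S lam x (x * s)%g / \sum_(u <- nbrs S x) hs_weight S lam x u.
Proof. by move=> sS; rewrite /stepp /homesick_p nbrsE map_f ?mem_undup. Qed.

Lemma stepp_sum (x : G) : \sum_(s <- undup S) stepp x s = 1.
Proof.
have W0 := hs_weight_sum_gt0 x.
transitivity (\sum_(s <- undup S) hs_weight S lam x (x * s)%g /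
    \sum_(u <- nbrs S x) hs_weight S lam x u).
  by apply: eq_big_seq => s; rewrite mem_undup => /steppE.
rewrite -mulr_suml {1}(_ : \sum_(s <- undup S) _ =
  \sum_(u <- nbrs S x) hs_weight S lam x u); last by rewrite nbrsE big_map.
by rewrite mulfV // gt_eqF.
Qed.

Definition kappa : R := (lam * (size S)%:R)^-1.

Lemma kappa_gt0 : 0 < kappa.
Proof.
have lam0 : 0 < lam by exact: lt_le_trans ltr01 lam1.
by rewrite invr_gt0 mulr_gt0 // ltr0n lt0n size_eq0.
Qed.

Lemma kappa_le1 : kappa <= 1.
Proof.
have n1 : 1 <= (size S)%:R :> R by rewrite ler1n lt0n size_eq0.
by rewrite invf_le1 ?mulr_ege1 // -invr_gt0 kappa_gt0.
Qed.

Lemma stepp_ge (x s : G) : s \in S -> kappa <= stepp x s.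
Proof.
move=> sS; rewrite steppE // -[kappa]mul1r; apply: ler_pM => //.
- by rewrite ltW // kappa_gt0.
- by have /andP[] := hs_weight_bounds x (x * s)%g.
rewrite lef_pV2 ?posrE ?hs_weight_sum_gt0 //; last first.
  by rewrite -invr_gt0 kappa_gt0.
apply: (@le_trans _ _ (\sum_(u <- nbrs S x) lam)).
  by apply: ler_sum => u _; have /andP[] := hs_weight_bounds x u.
have lam0 : 0 < lam by exact: lt_le_trans ltr01 lam1.
rewrite big_const_seq count_predT iter_addr_0 -[leLHS]mulr_natr ler_pM2l //.
by rewrite ler_nat nbrsE size_map size_undup.
Qed.

(* Trajectories are lists of increments with the most recent one at the head. *)
Fixpoint trajs (n : nat) : seq (seq G) :=
  if n is m.+1 then [seq s :: z | s <- undup S, z <- trajs m] else [:: [::]].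

Fixpoint pos (z : seq G) : G :=
  if z is s :: z' then (pos z' * s)%g else 1%g.

Fixpoint trajp (z : seq G) : R :=
  if z is s :: z' then trajp z' * stepp (pos z') s else 1.

(** The starting point at time 0 is counted. *)
Fixpoint visits (v : G) (z : seq G) : nat :=
  ((if z is _ :: z' then visits v z' else 0) + (pos z == v))%N.

Lemma trajp_ge0 (z : seq G) : 0 <= trajp z.
Proof. by elim: z => //= s z IH; rewrite mulr_ge0 // stepp_ge0. Qed.

Lemma visits_le v z : (visits v z <= (size z).+1)%N.
Proof.
elim: z => [|s z IH] /=; first by case: eqP.
by rewrite -addn1; apply: leq_add => //; case: eqP.
Qed.

Lemma trajs_size n z : z \in trajs n -> size z = n.
Proof.
elim: n z => [|n IH] z; first by rewrite inE => /eqP ->.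
by move=> /allpairsP[[s z'] /= [_ /IH <- ->]].
Qed.

Lemma sum_trajsS n (F : seq G -> R) :
  \sum_(z <- trajs n.+1) trajp z * F z =
  \sum_(z <- trajs n) trajp z *
    \sum_(s <- undup S) stepp (pos z) s * F (s :: z).
Proof.
rewrite /= big_allpairs_dep exchange_big /=; apply: eq_bigr => z _.
by rewrite mulr_sumr; apply: eq_bigr => s _; rewrite mulrA.
Qed.

Lemma sum_trajp n : \sum_(z <- trajs n) trajp z = 1.
Proof.
transitivity (\sum_(z <- trajs n) trajp z * 1); first by under [RHS]eq_bigr do rewrite mulr1.
elim: n => [|n IH]; first by rewrite big_seq1 mulr1.
rewrite sum_trajsS -[RHS]IH; apply: eq_bigr => z _.
by under eq_bigr do rewrite mulr1; rewrite stepp_sum.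
Qed.

(** * Visits to 1 between visits to a fixed vertex *)

Section Visits.
Variable v : G.
Hypothesis v1 : v != 1%g.

(** The Markov operator of the pair formed by the position and the number of visits to [v]. *)
Definition stepop (F : G -> nat -> R) (x : G) (c : nat) : R :=
  \sum_(s <- undup S) stepp x s * F (x * s)%g (c + ((x * s)%g == v))%N.

Lemma sum_trajs_stepop n (F : G -> nat -> R) :
  \sum_(z <- trajs n) trajp z * F (pos z) (visits v z) =
  iter n stepop F 1%g 0%N.
Proof.
elim: n F => [|n IH] F.
  by rewrite big_seq1 mul1r /= eq_sym (negPf v1).
by rewrite sum_trajsS iterSr -IH.
Qed.

(* [killed m x] is the expected number of visits to 1 before time [m] and
   before the first visit to [v], for the walk started at [x]. *)
Fixpoint killed (m : nat) (x : G) : R :=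
  if m is m'.+1 then (x == 1%g)%:R +
    \sum_(s <- undup S) stepp x s *
      (if (x * s)%g == v then 0 else killed m' (x * s)%g)
  else 0.

Lemma killed_ge0 m x : 0 <= killed m x.
Proof.
elim: m x => //= m IH x; rewrite addr_ge0 ?ler0n // sumr_ge0 // => s _.
by rewrite mulr_ge0 ?stepp_ge0 //; case: ifP.
Qed.

Lemma killed_leS m x : killed m x <= killed m.+1 x.
Proof.
elim: m x => [|m IH] x; first exact: killed_ge0.
rewrite [leLHS]/= [leRHS]/= lerD2l; apply: ler_sum => s _.
by rewrite ler_wpM2l ?stepp_ge0 //; case: ifP => // _; exact: IH.
Qed.

Lemma stepp_average (x : G) (F : G -> R) (M : R) : (forall y, F y <= M) ->
  \sum_(s <- undup S) stepp x s * F s <= M.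
Proof.
move=> FM; rewrite -[leRHS]mul1r -(stepp_sum x) mulr_suml ler_sum // => s _.
by rewrite ler_wpM2l ?stepp_ge0.
Qed.

(** Maximum principle: nothing is counted before the walk first reaches 1. *)
Lemma killed_le_start m x : killed m x <= killed m 1%g.
Proof.
elim: m x => // m IH x; have [->//|x1] := eqVneq x 1%g.
apply: le_trans (killed_leS m 1%g); rewrite /= (negPf x1) add0r.
by apply: stepp_average => s; case: ifP => // _; exact: killed_ge0.
Qed.

(* The walk follows [w] to [v] with probability at least [kappa ^+ size w]. *)
Lemma killed_near m (w : seq G) (x : G) :
  is_word S w -> (x * prodg w)%g = v ->
  (if x == v then 0 else killed m x) <=
    (size w)%:R + (1 - kappa ^+ size w) * killed m 1%g.
Proof.
elim: w x => [|s w IH] x /=.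
  by move=> _; rewrite mulg1 => ->; rewrite eqxx expr0 subrr mul0r addr0.
move=> /andP[sS wS]; rewrite mulgA => /(IH _ wS).
set K := killed m 1%g; set y := (x * s)%g; move=> IHy.
have K0 : 0 <= K by exact: killed_ge0.
have k0 := kappa_gt0.
have kw0 : 0 < kappa ^+ size w by exact: exprn_gt0.
have pk : kappa <= stepp x s by exact: stepp_ge.
have k1 := kappa_le1.
have kw1 : kappa ^+ (size w).+1 <= 1 by rewrite exprn_ile1 // ltW.
case: ifP => _.
  by rewrite addr_ge0 ?ler0n // mulr_ge0 // subr_ge0.
apply: le_trans (killed_leS m x) _; rewrite [leLHS]/=.
set h := fun z : G => if z == v then 0 else killed m z.
have hK z : h z <= K by rewrite /h; case: ifP => // _; exact: killed_le_start.
have -> : (size w).+1%:R = 1 + (size w)%:R :> R by rewrite mulrS.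
rewrite -addrA; apply: lerD; first by rewrite lern1; case: eqP.
rewrite (bigD1_seq s) ?undup_uniq ?mem_undup //= -/y -/(h y).
have rest : \sum_(t <- undup S | t != s) stepp x t * h (x * t)%g <=
    (1 - stepp x s) * K.
  rewrite -(stepp_sum x) (bigD1_seq s) ?undup_uniq ?mem_undup //= [stepp x s + _]addrC addrK.
  rewrite mulr_suml ler_sum // => t _.
  by rewrite ler_wpM2l ?stepp_ge0.
apply: le_trans (lerD (lexx _) rest) _.
(* As [h y <= K], the estimate is weakest when the step [s] has its least possible probability
   [kappa]. *)
have h1 : 0 <= (stepp x s - kappa) * (K - h y).
  by rewrite mulr_ge0 // subr_ge0.
have h2 : kappa * h y <= kappa * ((size w)%:R + (1 - kappa ^+ size w) * K).
  by rewrite ler_pM2l.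
have h3 : kappa * (size w)%:R <= (size w)%:R.
  by rewrite ler_piMl.
by rewrite exprS; lra.
Qed.

(** Applied at [x = 1], [killed_near] bounds [K] by [size w + (1 - kappa ^+ size w) * K], which is
    solved for [K]. *)
Lemma killed_bound r m : v \in cball S r ->
  killed m 1%g <= r%:R / kappa ^+ r.
Proof.
move=> /cball_word[w [wS wr wv]].
have := @killed_near m w 1%g wS; rewrite mul1g eq_sym (negPf v1) => /(_ wv).
set K := killed m 1%g => h.
have k0 : 0 < kappa ^+ r by exact/exprn_gt0/kappa_gt0.
rewrite ler_pdivlMr //.
have K0 : 0 <= K by exact: killed_ge0.
have : kappa ^+ r <= kappa ^+ size w.
  by rewrite ler_wiXn2l ?kappa_le1 // ltW // kappa_gt0.
have : (size w)%:R <= r%:R :> R by rewrite ler_nat.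
by move=> h1 h2; have := ler_wpM2l K0 h2; lra.
Qed.

(* [c] counts the visits to [v] so far: walks with [c < j] are averaged, at
   [c = j] the walk is killed at [v], and [c > j] contributes nothing. *)
Lemma visits_level r N j : v \in cball S r ->
  \sum_(n < N) \sum_(z <- trajs n)
     trajp z * ((pos z == 1%g) && (visits v z == j))%:R <= r%:R / kappa ^+ r.
Proof.
move=> vr; pose Phi (x : G) (c : nat) : R := ((x == 1%g) && (c == j))%:R.
(* Expected number of times before [m] at which the walk is at 1 with count exactly [j], started at
   [x] with count [c]. *)
pose U m x c := \sum_(n < m) iter n stepop Phi x c.
have US m x c : U m.+1 x c = Phi x c + stepop (U m) x c.
  rewrite /U big_ord_recl /=; congr (_ + _); rewrite /stepop.
  under [RHS]eq_bigr do rewrite mulr_sumr.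
  by rewrite exchange_big.
have Ugt m x c : (j < c)%N -> U m x c = 0.
  elim: m x c => [|m IH] x c jc; first by rewrite /U big_ord0.
  rewrite US /Phi (gtn_eqF jc) andbF add0r /stepop big1 // => s _.
  by rewrite IH ?mulr0 // (leq_trans jc) ?leq_addr.
have Ueq m x : U m x j = killed m x.
  elim: m x => [|m IH] x; first by rewrite /U big_ord0.
  rewrite US /Phi eqxx andbT /=; congr (_ + _); apply: eq_bigr => s _.
  by case: eqP => _; rewrite ?addn0 ?IH // addn1 Ugt.
have UB m x c : U m x c <= r%:R / kappa ^+ r.
  have B0 : 0 <= r%:R / kappa ^+ r.
    by rewrite divr_ge0 ?ler0n // exprn_ge0 // ltW // kappa_gt0.
  elim: m x c => [|m IH] x c; first by rewrite /U big_ord0.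
  have [jc|cj|<-] := ltngtP j c; first by rewrite Ugt.
    rewrite US /Phi (ltn_eqF cj) andbF add0r; exact: stepp_average.
  by rewrite Ueq; apply: le_trans (killed_le_start _ _) (killed_bound _ vr).
apply: le_trans (UB N 1%g 0%N); rewrite /U ler_sum // => n _.
by rewrite -(sum_trajs_stepop n Phi).
Qed.

Lemma sum_visits r N (g : nat -> R) (C : R) : v \in cball S r ->
  (forall j, 0 <= g j) -> (forall N, \sum_(j < N) g j <= C) ->
  \sum_(n < N) \sum_(z <- trajs n) trajp z * ((pos z == 1%g)%:R * g (visits v z))
    <= r%:R / kappa ^+ r * C.
Proof.
move=> vr g0 gC.
have B0 : 0 <= r%:R / kappa ^+ r.
  by rewrite divr_ge0 ?ler0n // exprn_ge0 // ltW // kappa_gt0.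
(* Split by the value of [visits], which is at most [n + 1 <= N] on trajectories of length
   [n < N]. *)
apply: (@le_trans _ _ (\sum_(j < N.+1) g j * (r%:R / kappa ^+ r))); last first.
  by rewrite -mulr_suml mulrC ler_wpM2l.
apply: (@le_trans _ _ (\sum_(j < N.+1) g j * \sum_(n < N) \sum_(z <- trajs n)
     trajp z * ((pos z == 1%g) && (visits v z == j))%:R)); last first.
  by apply: ler_sum => j _; rewrite ler_wpM2l //; exact: visits_level.
under [leRHS]eq_bigr do rewrite mulr_sumr.
rewrite exchange_big; apply: ler_sum => n _ /=.
under [leRHS]eq_bigr do rewrite mulr_sumr.
rewrite exchange_big /= le_eqVlt; apply/orP; left; apply/eqP.
apply: eq_big_seq => z /trajs_size zn.
have vN : (visits v z < N.+1)%N by rewrite ltnS; apply: leq_trans (visits_le v z) _; rewrite zn.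
rewrite (bigD1 (Ordinal vN)) //= eqxx andbT big1 ?addr0.
  by rewrite mulrA mulrC.
move=> j jv; have -> : (visits v z == j :> nat) = false.
  by apply/negbTE; apply: contra jv => /eqP e; apply/eqP/val_inj.
by rewrite andbF !mulr0.
Qed.

End Visits.
End HomesickWalk.

(** * Law of the lamps along a trajectory *)

Section LampConfiguration.
Variables (R : realType) (G H : groupType) (S : seq G) (lam : R).
Variables (mu : H -> R) (A : seq H).
Hypothesis lam1 : 1 <= lam.
Hypothesis S0 : S != [::].
Hypothesis mu_gt0 : forall s, s \in A -> 0 < mu s.
Hypothesis mu_sum : \sum_(s <- A) mu s = 1.

(* A step [(s, (h, k))] multiplies the position by [s], the lamp at the old
   position by [h] and then the lamp at the new position by [k]. *)
Definition jsteps : seq (G * (H * H)) :=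
  [seq (s, p) | s <- undup S, p <- [seq (h, k) | h <- A, k <- A]].

Fixpoint jtrajs (n : nat) : seq (seq (G * (H * H))) :=
  if n is m.+1 then [seq e :: t | e <- jsteps, t <- jtrajs m] else [:: [::]].

Definition jpos (t : seq (G * (H * H))) : G := pos (unzip1 t).

Fixpoint jtrajp (t : seq (G * (H * H))) : R :=
  if t is e :: t' then
    jtrajp t' * (stepp S lam (jpos t') e.1 * mu e.2.1 * mu e.2.2)
  else 1.

Fixpoint jlamps (t : seq (G * (H * H))) : G -> H :=
  if t is e :: t' then
    lamp_update (lamp_update (jlamps t') (jpos t') e.2.1) (jpos t) e.2.2
  else fun=> 1%g.

Fixpoint updates (x : G) (z : seq G) : nat :=
  if z is s :: z' then (updates x z' + (x == pos z') + (x == pos z))%N else 0%N.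

Lemma sum_jtrajsS n (F : seq (G * (H * H)) -> R) :
  \sum_(t <- jtrajs n.+1) jtrajp t * F t =
  \sum_(s <- undup S) \sum_(k <- A) mu k * \sum_(h <- A) mu h *
    \sum_(t <- jtrajs n) jtrajp t *
      (stepp S lam (jpos t) s * F ((s, (h, k)) :: t)).
Proof.
rewrite /= big_allpairs_dep /jsteps big_allpairs_dep; apply: eq_bigr => s _.
rewrite big_allpairs_dep exchange_big; apply: eq_bigr => k _ /=.
rewrite mulr_sumr; apply: eq_bigr => h _.
by rewrite !mulr_sumr; apply: eq_bigr => t _ /=; ring.
Qed.

Lemma jtrajp_ge0 n t : t \in jtrajs n -> 0 <= jtrajp t.
Proof.
elim: n t => [|n IH] t; first by rewrite inE => /eqP ->.
move=> /allpairsP[[e t'] /= [eA /IH t0 ->]] /=.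
move: eA => /allpairsP[[s p] /= [_ pA ->]] /=.
move: pA => /allpairsP[[h k] /= [hA kA ->]] /=.
by rewrite !mulr_ge0 ?stepp_ge0 // ltW // mu_gt0.
Qed.

Lemma lamp_update_eq (L eta : G -> H) (y x : G) (h : H) :
  (lamp_update L y h x == eta x) = (L x == lamp_update eta y h^-1%g x).
Proof.
rewrite /lamp_update; case: (x =P y) => // _.
by apply/idP/idP => /eqP e; apply/eqP; rewrite -?e ?mulgK // e mulgVK.
Qed.

(** Averaging over one switch at [y] is one convolution step for that lamp; if [y] is outside [F],
    the weights just sum to 1. *)
Lemma sum_lamp_update (F : seq G) (c : G -> nat) (eta : G -> H) (y : G) :
  uniq F ->
  \sum_(h <- A) mu h *
    \prod_(x <- F) convp mu A (c x) (lamp_update eta y h^-1%g x) =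
  \prod_(x <- F) convp mu A (c x + (x == y)) (eta x).
Proof.
move=> uF; have other h (P : pred G) : (forall x, P x -> x != y) ->
    \prod_(x <- F | P x) convp mu A (c x) (lamp_update eta y h^-1%g x) =
    \prod_(x <- F | P x) convp mu A (c x + (x == y)) (eta x).
  move=> Py; apply: eq_bigr => x /Py /negPf xy.
  by rewrite /lamp_update xy addn0.
have [yF|yF] := boolP (y \in F).
  rewrite [RHS](bigD1_seq y) //= eqxx addn1 convpS mulr_suml.
  apply: eq_bigr => h _; rewrite (bigD1_seq y) //= other //.
  by rewrite /lamp_update eqxx mulrA.
rewrite -[RHS]mul1r -[X in _ = X * _]mu_sum mulr_suml; apply: eq_bigr => h _.
congr (_ * _); rewrite big_seq [RHS]big_seq.
apply: (other h (fun x => x \in F)) => x xF.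
by apply: contraNneq yF => <-.
Qed.

(** Given the trajectory, the lamps in [F] are independent with convolution powers as laws. The
    target [eta] may depend on the trajectory because the induction absorbs the last two switches
    into it. *)
Lemma lamp_law (F : seq G) n (Phi : seq G -> R) (eta : seq G -> G -> H) :
  uniq F ->
  \sum_(t <- jtrajs n) jtrajp t * (Phi (unzip1 t) *
    (all (fun x => jlamps t x == eta (unzip1 t) x) F)%:R) =
  \sum_(z <- trajs S n) trajp S lam z * (Phi z *
    \prod_(x <- F) convp mu A (updates x z) (eta z x)).
Proof.
move=> uF; elim: n Phi eta => [|n IH] Phi eta.
  rewrite !big_seq1 /= !mul1r; congr (_ * _).
  elim: (F) => [|x F' IHF]; first by rewrite big_nil.
  by rewrite /= big_cons -IHF convp0 -natrM mulnb eq_sym.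
rewrite sum_jtrajsS sum_trajsS.
transitivity (\sum_(s <- undup S) \sum_(k <- A) mu k * \sum_(h <- A) mu h *
    \sum_(z <- trajs S n) trajp S lam z * (stepp S lam (pos z) s * Phi (s :: z) *
      \prod_(x <- F) convp mu A (updates x z)
        (lamp_update (lamp_update (eta (s :: z)) (pos (s :: z)) k^-1%g)
           (pos z) h^-1%g x))).
  apply: eq_bigr => s _; apply: eq_bigr => k _; congr (_ * _).
  apply: eq_bigr => h _; congr (_ * _).
  rewrite -(IH (fun z => stepp S lam (pos z) s * Phi (s :: z)) (fun z =>
    lamp_update (lamp_update (eta (s :: z)) (pos (s :: z)) k^-1%g)
           (pos z) h^-1%g)).
  apply: eq_bigr => t _; rewrite -!mulrA; congr (_ * (_ * (_ * _%:R))).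
  by congr nat_of_bool; apply: eq_all => x /=; rewrite !lamp_update_eq.
under [RHS]eq_bigr do rewrite mulr_sumr.
rewrite [RHS]exchange_big /=; apply: eq_bigr => s _.
transitivity (\sum_(z <- trajs S n) \sum_(k <- A) mu k * \sum_(h <- A) mu h *
    (trajp S lam z * (stepp S lam (pos z) s * Phi (s :: z) *
      \prod_(x <- F) convp mu A (updates x z)
        (lamp_update (lamp_update (eta (s :: z)) (pos (s :: z)) k^-1%g)
           (pos z) h^-1%g x)))).
  rewrite exchange_big; apply: eq_bigr => k _ /=; rewrite -mulr_sumr.
  by congr (_ * _); rewrite exchange_big; apply: eq_bigr => h _; rewrite mulr_sumr.
apply: eq_bigr => z _.
transitivity (\sum_(k <- A)
    (trajp S lam z * (stepp S lam (pos z) s * Phi (s :: z))) *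
    (mu k * \prod_(x <- F) convp mu A (updates x z + (x == pos z))
      (lamp_update (eta (s :: z)) (pos (s :: z)) k^-1%g x))).
  apply: eq_bigr => k _; rewrite -sum_lamp_update // [RHS]mulrCA.
  by congr (_ * _); rewrite mulr_sumr; apply: eq_bigr => h _; ring.
by rewrite -mulr_sumr sum_lamp_update // -!mulrA.
Qed.

(** A visit brings one increment on arrival and one on departure; the start lacks the arrival and
    the end lacks the departure. *)
Lemma updates_visits (x : G) (z : seq G) :
  (updates x z + (x == pos z) + (x == 1%g) = (visits x z).*2)%N.
Proof.
elim: z => [|s z IH]; first by rewrite /= eq_sym; case: eqP.
rewrite [updates _ _]/= [visits _ _]/= -[(pos z * s)%g]/(pos (s :: z)).
rewrite doubleD -IH [pos (s :: z) == x]eq_sym; clear lam1 S0; lia.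
Qed.

(** On a loop at 1, both endpoint corrections of [updates_visits] vanish for vertices other than
    1. *)
Lemma loop_law (F : seq G) n : uniq F -> 1%g \notin F ->
  \sum_(t <- jtrajs n) jtrajp t * ((jpos t == 1%g) &&
    all (fun x => jlamps t x == 1%g) F)%:R =
  \sum_(z <- trajs S n) trajp S lam z * ((pos z == 1%g)%:R *
    \prod_(x <- F) returnp mu A (visits x z)).
Proof.
move=> uF F1.
transitivity (\sum_(t <- jtrajs n) jtrajp t * ((pos (unzip1 t) == 1%g)%:R *
    (all (fun x => jlamps t x == 1%g) F)%:R)).
  by apply: eq_bigr => t _; rewrite -natrM mulnb.
rewrite (lamp_law n (fun z => (pos z == 1%g)%:R) (fun _ _ => 1%g)) //.
apply: eq_bigr => z _; have [z1|] := eqVneq (pos z) 1%g; last by rewrite !mul0r.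
congr (_ * (_ * _)); apply: eq_big_seq => x xF; rewrite /returnp.
have /negPf x1 : x != 1%g by apply: contraNneq F1 => <-.
by rewrite -updates_visits z1 x1 !addn0.
Qed.

End LampConfiguration.

(** * Return events *)

Section Cylinders.
Variables (R : realType) (d : measure_display) (Om : measurableType d).
Variables (P : probability Om R) (G H : groupType) (S : seq G) (lam : R).
Variables (mu : H -> R) (A : seq H).
Variables (Z : nat -> Om -> G) (U V : nat -> Om -> H).
Hypothesis lam1 : 1 <= lam.
Hypothesis S0 : S != [::].
Hypothesis Auniq : uniq A.
Hypothesis mu_gt0 : forall s, s \in A -> 0 < mu s.
Hypothesis mu_sum : \sum_(s <- A) mu s = 1.
Hypothesis law : stationary_rw_law P S lam mu Z U V.

Local Notation jtraj := (seq (G * (H * H))).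

Fixpoint cyl (t : jtraj) : set Om :=
  if t is e :: t' then cyl t' `&`
    ([set w | Z (size t) w = jpos t] `&`
     ([set w | U (size t) w = e.2.1] `&` [set w | V (size t) w = e.2.2]))
  else [set w | Z 0 w = 1%g].

Fixpoint path_pos (t : jtraj) : seq G :=
  if t is e :: t' then rcons (path_pos t') (jpos t) else [:: 1%g].
Fixpoint path_U (t : jtraj) : seq H :=
  if t is e :: t' then rcons (path_U t') e.2.1 else [::].
Fixpoint path_V (t : jtraj) : seq H :=
  if t is e :: t' then rcons (path_V t') e.2.2 else [::].

Lemma size_path_pos t : size (path_pos t) = (size t).+1.
Proof. by elim: t => //= e t IH; rewrite size_rcons IH. Qed.
Lemma size_path_U t : size (path_U t) = size t.
Proof. by elim: t => //= e t IH; rewrite size_rcons IH. Qed.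
Lemma size_path_V t : size (path_V t) = size t.
Proof. by elim: t => //= e t IH; rewrite size_rcons IH. Qed.

Lemma measurable_cyl t : measurable (cyl t).
Proof.
have [mZ [mU [mV _]]] := law.
elim: t => [|e t IH] /=; first exact: mZ.
by do !apply: measurableI.
Qed.

Lemma cylE t : cyl t = [set w |
  (forall i, (i <= size t)%N -> Z i w = nth 1%g (path_pos t) i) /\
  (forall i, (i < size t)%N -> U i.+1 w = nth 1%g (path_U t) i /\
                               V i.+1 w = nth 1%g (path_V t) i)].
Proof.
elim: t => [|e t IH].
  apply/seteqP; split => w /=.
    by move=> Zw; split=> // i; rewrite leqn0 => /eqP ->.
  by move=> [/(_ 0%N isT)].
rewrite [cyl _]/= IH; apply/seteqP; split => w /=.
  move=> [[hZ hUV] [hz [hu hv]]]; split=> i /= ilt; rewrite !nth_rcons.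
    rewrite size_path_pos; case: (ltngtP i (size t).+1) ilt => // [it _|-> _ //].
    exact: hZ.
  rewrite size_path_U size_path_V; rewrite ltnS in ilt.
  by case: (ltngtP i (size t)) ilt => // [it _|-> _ //]; exact: hUV.
move=> [hZ hUV]; split; [split=> i ilt|split; last split].
- by have := hZ i (leqW ilt); rewrite nth_rcons size_path_pos ltnS ilt.
- have := hUV i (leqW ilt).
  by rewrite !nth_rcons size_path_U size_path_V ilt.
- by have := hZ _ (leqnn _); rewrite nth_rcons size_path_pos ltnn eqxx.
- by have [+ _] := hUV _ (leqnn _); rewrite nth_rcons size_path_U ltnn eqxx.
by have [_] := hUV _ (leqnn _); rewrite nth_rcons size_path_V ltnn eqxx.
Qed.

Lemma path_pos_last t x : nth x (path_pos t) (size t) = jpos t.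
Proof.
case: t => [|e t] //; rewrite [path_pos _]/= nth_rcons size_path_pos.
by rewrite ltnn eqxx.
Qed.

Lemma prob_cyl t : P (cyl t) = (jtrajp S lam mu t)%:E.
Proof.
have [_ [_ [_ fdd]]] := law; rewrite cylE.
rewrite (fdd (size t)) ?size_path_pos ?size_path_U ?size_path_V //; congr EFin.
have head1 s : nth 1%g (path_pos s) 0 = 1%g.
  by elim: s => //= e s IH; rewrite nth_rcons size_path_pos.
rewrite head1 eqxx mul1r; elim: t => [|e t IH]; first by rewrite !big_ord0 !mul1r.
rewrite [jtrajp _ _ _ _]/= -IH !big_ord_recr /=.
rewrite !nth_rcons size_path_pos size_path_U size_path_V ltnSn !ltnn !eqxx.
rewrite path_pos_last.
under eq_bigr => i _ do rewrite !nth_rcons size_path_pos !ltnS ltnW ?ltn_ord //.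
under [X in _ * (X * _) * _]eq_bigr => i _ do
  rewrite !nth_rcons size_path_U ltn_ord.
under [X in _ * (X * _) = _]eq_bigr => i _ do
  rewrite !nth_rcons size_path_V ltn_ord.
rewrite /stepp; ring.
Qed.

Lemma cyl_inj t t' w : size t = size t' -> cyl t w -> cyl t' w -> t = t'.
Proof.
move=> st ct ct'; have jposE s : cyl s w -> Z (size s) w = jpos s.
  by case: s => [|e s] //= [_ []].
elim: t t' st ct ct' => [|[s [h k]] t IH] [|[s' [h' k']] t'] //= [st].
move=> [ct [zt [ut vt]]] [ct' [zt' [ut' vt']]].
have tt := IH _ st ct ct'; subst t'.
congr (_ :: _); congr (_, (_, _)).
- by move: zt; rewrite zt' => /mulgI.
- by rewrite -ut ut'.
by rewrite -vt vt'.
Qed.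

Lemma cyl_lamps t w : cyl t w -> lamps Z U V (size t) w = jlamps t.
Proof.
have jposE s : cyl s w -> Z (size s) w = jpos s.
  by case: s => [|e s] //= [_ []].
elim: t => [//|e t IH] /= [ct [zt [ut vt]]].
by rewrite IH // zt ut vt (jposE _ ct).
Qed.

Lemma jtrajs_size n t : t \in jtrajs S A n -> size t = n.
Proof.
elim: n t => [|n IH] t; first by rewrite inE => /eqP ->.
by move=> /allpairsP[[s z'] /= [_ /IH <- ->]].
Qed.

Lemma jtrajs_uniq n : uniq (jtrajs S A n).
Proof.
elim: n => //= n IH; apply: allpairs_uniq => //.
  rewrite /jsteps; apply: allpairs_uniq; rewrite ?undup_uniq //.
    by apply: allpairs_uniq => // -[? ?] [? ?] _ _ [-> ->].
  by move=> [? ?] [? ?] _ _ [-> ->].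
by move=> [? ?] [? ?] _ _ [-> ->].
Qed.

Definition cylU (L : seq jtraj) : set Om := \big[setU/set0]_(t <- L) cyl t.

Lemma measurable_cylU L : measurable (cylU L).
Proof. by apply: bigsetU_measurable => t _; exact: measurable_cyl. Qed.

Lemma cylUP L w : cylU L w <-> exists2 t, t \in L & cyl t w.
Proof.
rewrite /cylU; elim: L => [|t L IH]; first by rewrite big_nil; split=> // -[].
rewrite big_cons; split.
  move=> [ct|/IH[t' tL ct']]; first by exists t; rewrite ?mem_head.
  by exists t'; rewrite // inE tL orbT.
move=> [t']; rewrite inE => /orP[/eqP -> ct|tL ct]; first by left.
by right; apply/IH; exists t'.
Qed.

Lemma prob_cylU n (L : seq jtraj) : uniq L -> {subset L <= jtrajs S A n} ->
  P (cylU L) = (\sum_(t <- L) jtrajp S lam mu t)%:E.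
Proof.
elim: L => [|t L IH] /=; first by rewrite /cylU !big_nil measure0.
move=> /andP[tL uL] sL; rewrite /cylU !big_cons -/(cylU L) measureU.
- rewrite EFinD; congr (_ + _)%E; first exact: prob_cyl.
  by apply: IH => // t' tL'; apply: sL; rewrite inE tL' orbT.
- exact: measurable_cyl.
- exact: measurable_cylU.
apply/seteqP; split => // w [ct /cylUP[t' tL' ct']].
move: tL; rewrite (cyl_inj _ ct ct') ?tL' //.
by rewrite !(@jtrajs_size n) // sL // inE ?eqxx ?tL' ?orbT.
Qed.

Lemma sum_jtrajp n : \sum_(t <- jtrajs S A n) jtrajp S lam mu t = 1.
Proof.
transitivity (\sum_(t <- jtrajs S A n) jtrajp S lam mu t *
    (1 * (all (fun x => jlamps t x == 1%g) [::])%:R)).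
  by apply: eq_bigr => t _; rewrite !mulr1.
rewrite (@lamp_law _ _ _ S lam mu A mu_sum [::] n (fun=> 1) (fun _ _ => 1%g)) //.
rewrite -[RHS](sum_trajp lam1 S0 n).
by apply: eq_bigr => z _; rewrite big_nil !mulr1.
Qed.

(* The second part is a null set, off which the walk follows a trajectory of
   positive probability; it makes the event measurable. *)
Definition returnE n : set Om :=
  cylU [seq t <- jtrajs S A n | `[< jpos t = 1%g /\ forall g, jlamps t g = 1%g >]]
  `|` ~` cylU (jtrajs S A n).

Lemma measurable_returnE n : measurable (returnE n).
Proof. by apply: measurableU; [|apply: measurableC]; exact: measurable_cylU. Qed.

Lemma at_identity_returnE n w : at_identity Z U V n w -> returnE n w.
Proof.
move=> [hl hz].
have [/cylUP[t tn ct]|] := pselect (cylU (jtrajs S A n) w); last by right.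
left; apply/cylUP; exists t => //; rewrite mem_filter tn andbT.
have sn := jtrajs_size tn; apply/asboolP; split.
  by rewrite -hz -sn; case: (t) ct => [|e s] //= [_ []].
by move=> g; rewrite -(cyl_lamps ct) sn.
Qed.

(** The trajectories miss only a null set, and a return has in particular all lamps in [F] off. *)
Lemma prob_returnE (F : seq G) n : uniq F -> 1%g \notin F ->
  (P (returnE n) <= (\sum_(z <- trajs S n) trajp S lam z *
     ((pos z == 1%g)%:R * \prod_(x <- F) returnp mu A (visits x z)))%:E)%E.
Proof.
move=> uF F1; rewrite -(@loop_law _ _ _ S lam mu A mu_sum F n uF F1).
have null : P (~` cylU (jtrajs S A n)) = 0%E.
  rewrite probability_setC; last exact: measurable_cylU.
  by rewrite (@prob_cylU n) ?jtrajs_uniq // sum_jtrajp subee.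
have -> : P (returnE n) = P (cylU [seq t <- jtrajs S A n |
    `[< jpos t = 1%g /\ forall g, jlamps t g = 1%g >]]).
  by apply: measureU0 => //; [|apply: measurableC]; exact: measurable_cylU.
rewrite (@prob_cylU n); first last.
- by move=> t; rewrite mem_filter => /andP[].
- by rewrite filter_uniq // jtrajs_uniq.
rewrite lee_fin big_filter big_mkcond /= big_seq [leRHS]big_seq.
apply: ler_sum => t tn; have t0 := jtrajp_ge0 lam1 mu_gt0 tn.
case: asboolP => [[-> hl]|_]; last by rewrite mulr_ge0.
rewrite eqxx (_ : all _ F = true) ?mulr1 //.
by apply/allP => x _; rewrite hl.
Qed.

(* Borel-Cantelli, in terms of the expected number of returns. *)
Lemma ae_transient (C : R) :
  (forall N, (\sum_(n < N) P (returnE n) <= C%:E)%E) ->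
  {ae P, forall w, exists N : nat, forall n : nat, (N <= n)%N ->
      ~ at_identity Z U V n w}.
Proof.
move=> bnd; have ls0 : P (lim_sup_set returnE) = 0%E.
  apply: lim_sup_set_cvg0; first exact: measurable_returnE.
  apply: (@le_lt_trans _ _ C%:E); last exact: ltry.
  apply: lime_le; first exact: is_cvg_nneseries.
  by apply: nearW => N; rewrite big_mkord.
exists (lim_sup_set returnE); split=> //.
  apply: bigcapT_measurable => n; apply: bigcup_measurable => k _.
  exact: measurable_returnE.
move=> w /= hw n _; apply: contrapT => hn; apply: hw; exists n => k nk ak.
by apply: hn; exists k => //; exact: at_identity_returnE.
Qed.

End Cylinders.

(** * Expected number of returns *)

Section ReturnBound.
Variables (R : realType) (d : measure_display) (Om : measurableType d).
Variables (P : probability Om R) (G H : groupType) (S : seq G) (lam : R).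
Variables (mu : H -> R) (A : seq H).
Variables (Z : nat -> Om -> G) (U V : nat -> Om -> H).
Hypothesis lam1 : 1 <= lam.
Hypothesis S0 : S != [::].
Hypothesis Auniq : uniq A.
Hypothesis mu_gt0 : forall s, s \in A -> 0 < mu s.
Hypothesis mu_sum : \sum_(s <- A) mu s = 1.
Hypothesis law : stationary_rw_law P S lam mu Z U V.

(** Common to both cases: once the product over lamps is dominated by a sum of functions of single
    visit counts, [sum_visits] treats each vertex separately. The error [eps] is paid once per time,
    so it may be chosen after [N]. *)
Lemma sum_prob_returnE (F : seq G) (g : G -> nat -> R) (r : G -> nat)
    (C : G -> R) (eps : R) (N : nat) :
  uniq F -> 1%g \notin F -> (forall x, x \in F -> x \in cball S (r x)) ->
  (forall x j, 0 <= g x j) -> (forall x N, \sum_(j < N) g x j <= C x) ->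
  (forall c : G -> nat, \prod_(x <- F) returnp mu A (c x) <=
     \sum_(x <- F) g x (c x) + eps) ->
  0 <= eps ->
  (\sum_(n < N) P (returnE S A Z U V n) <=
    (\sum_(x <- F) (r x)%:R / kappa S lam ^+ r x * C x + N%:R * eps)%:E)%E.
Proof.
move=> uF F1 Fr g0 gC prodF eps0.
apply: (@le_trans _ _ (\sum_(n < N) (\sum_(z <- trajs S n) trajp S lam z *
     ((pos z == 1%g)%:R * \prod_(x <- F) returnp mu A (visits x z)))%:E)%E).
  by apply: lee_sum => n _; exact: prob_returnE.
rewrite sumEFin lee_fin.
apply: (@le_trans _ _ (\sum_(n < N) (\sum_(x <- F) \sum_(z <- trajs S n)
    trajp S lam z * ((pos z == 1%g)%:R * g x (visits x z)) + eps))).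
  apply: ler_sum => n _; rewrite -[X in _ + X]mul1r -[X in _ + X * _](sum_trajp lam1 S0 n).
  rewrite exchange_big mulr_suml -big_split /=.
  apply: ler_sum => z _; rewrite -mulr_sumr -mulrDr.
  apply: ler_wpM2l; first exact: trajp_ge0.
  rewrite -[X in _ <= X + _]mulr_sumr.
  by case: eqP => _; rewrite ?mul1r ?mul0r ?add0r //; exact: prodF.
rewrite big_split sumr_const card_ord mulr_natl lerD2r exchange_big /=.
rewrite big_seq [leRHS]big_seq; apply: ler_sum => x xF.
apply: sum_visits => //; last exact: Fr.
by apply: contraNneq F1 => <-.
Qed.

End ReturnBound.

(** * Auxiliary estimates for the two cases *)

Lemma infinite_group_uniq (G : groupType) : ~ finite_group G ->
  forall n, exists L : seq G, [/\ uniq L, size L = n & 1%g \notin L].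
Proof.
move=> Ginf; elim=> [|n [L [uL sL L1]]]; first by exists [::].
have [g gL] : exists g, g \notin 1%g :: L.
  apply: contrapT => h; apply: Ginf; exists (1%g :: L) => g.
  by apply: contrapT => /negP gL; apply: h; exists g.
move: gL; rewrite inE negb_or => /andP[g1 gL].
by exists (g :: L); rewrite /= gL uL sL inE negb_or eq_sym g1 L1.
Qed.

Lemma prod4_le_sum (R : realDomainType) (a b c e : R) :
  0 <= a -> 0 <= b -> 0 <= c -> 0 <= e ->
  a * (b * (c * e)) <= a ^+ 4 + b ^+ 4 + c ^+ 4 + e ^+ 4.
Proof.
move=> a0 b0 c0 e0.
have h1 : 0 <= (a * b - c * e) ^+ 2 by exact: sqr_ge0.
have h2 : 0 <= (a ^+ 2 - b ^+ 2) ^+ 2 by exact: sqr_ge0.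
have h3 : 0 <= (c ^+ 2 - e ^+ 2) ^+ 2 by exact: sqr_ge0.
have h4 : 0 <= (a * b) ^+ 2 by exact: sqr_ge0.
have h5 : 0 <= (c * e) ^+ 2 by exact: sqr_ge0.
nra.
Qed.

Lemma sum_eventually_geometric (R : realType) (u : nat -> R) (r0 : nat) :
  (forall r, 0 <= u r) -> (forall r, (r0 <= r)%N -> u r <= 2^-1 ^+ r) ->
  exists C, forall N, \sum_(r < N) u r <= C.
Proof.
move=> u0 ug; exists (\sum_(r < r0) u r + 2) => N.
apply: (@le_trans _ _ (\sum_(r < r0 + N) u r)).
  by rewrite addnC big_split_ord /= lerDl sumr_ge0.
rewrite big_split_ord lerD2l /=.
have geo M : \sum_(i < M) (2^-1 : R) ^+ i <= 2 - 2 * 2^-1 ^+ M.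
  elim: M => [|M IH]; first by rewrite big_ord0 expr0; lra.
  have : 0 <= (2^-1 : R) ^+ M by rewrite exprn_ge0 // invr_ge0.
  by rewrite big_ord_recr exprS /=; lra.
apply: (@le_trans _ _ (\sum_(i < N) (2^-1 : R) ^+ i)).
  apply: ler_sum => i _; apply: le_trans (ug _ (leq_addr _ _)) _.
  by rewrite ler_wiXn2l ?leq_addl // ?invr_ge0 // invf_le1 // ler1n.
by apply: le_trans (geo N) _; rewrite lerBlDr lerDl mulr_ge0 ?exprn_ge0 ?invr_ge0.
Qed.

(** A single uniform factor already makes the product uniform. *)
Lemma returnp_uniform (R : realType) (H : groupType) (mu : H -> R) (A : seq H) :
  uniq A -> (forall h, h \in A) -> (forall h, mu h = (size A)%:R^-1) ->
  forall j, returnp mu A j = if j == 0%N then 1 else (size A)%:R^-1.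
Proof.
move=> uA Aall muE; set m := (size A)%:R^-1.
have conv n x : convp mu A n.+1 x = m.
  elim: n x => [|n IH] x; rewrite convpS.
    rewrite (bigD1_seq x) //= convp0 mulgV eqxx mulr1 big1 ?addr0 // => s sx.
    rewrite convp0 (_ : (x * s^-1)%g == 1%g = false) ?mulr0 //.
    by apply/negbTE; apply: contra sx; rewrite divg_eq1 eq_sym.
  under eq_bigr do rewrite IH muE.
  rewrite big_const_seq count_predT iter_addr_0 -[LHS]mulr_natl mulrA mulfV ?mul1r //.
  by rewrite pnatr_eq0 -lt0n; case: (A) (Aall 1%g).
by case=> [|j]; rewrite /returnp ?convp0 ?eqxx //= doubleS conv.
Qed.

Lemma prod_le_exp (R : realDomainType) (T : eqType) (F L : seq T) (q : R)
    (a : T -> R) :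
  0 <= q -> uniq F -> uniq L -> {subset L <= F} ->
  (forall x, x \in F -> 0 <= a x <= 1) -> (forall x, x \in L -> a x = q) ->
  \prod_(x <- F) a x <= q ^+ size L.
Proof.
move=> q0 uF uL LF a01 aL.
rewrite (bigID (mem L)) /= -big_filter (perm_big L) /=; last first.
  apply: uniq_perm; rewrite ?filter_uniq // => x; rewrite mem_filter.
  by have [/LF|] := boolP (x \in L).
have -> : \prod_(x <- L) a x = q ^+ size L.
  rewrite big_seq (eq_bigr (fun=> q)) // -big_seq.
  by rewrite big_const_seq count_predT iter_mulr_1.
apply: ler_piMr; first exact: exprn_ge0.
rewrite big_seq_cond; apply: prodr_ile1 => x /andP[xF _]; exact: a01.
Qed.

(** * Finite lamp groups *)

Section FiniteLamps.
Variables (R : realType) (G : groupType) (S : seq G) (m : nat).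
Hypotheses (Ssym : symmetric_set S) (Sgen : generates (fun x => x \in S)).
Hypothesis m2 : (2 <= m)%N.
Local Notation wl := (wlen Ssym Sgen).
Local Notation q := (m%:R^-1 : R).

Let b (r : nat) := size (cball S r).
Let F (r : nat) := [seq x <- cball S r | x != 1%g].

Lemma size_punctured_ball r : size (F r) = (b r).-1.
Proof.
rewrite /F -rem_filter ?cball_uniq // size_rem //; exact: mem1_cball.
Qed.

Lemma inv_card_le : 0 <= q <= 2^-1.
Proof.
rewrite invr_ge0 ler0n lef_pV2 ?posrE ?ltr0n ?ler_nat // (leq_trans _ m2) //.
Qed.

(* An unvisited vertex closest to 1, at distance [r], has the whole punctured
   ball of radius [r - 1] visited. *)
Lemma prod_visited_le n (c : G -> nat) :
  \prod_(x <- F n) (if c x == 0%N then 1 else q) <=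
  \sum_(x <- F n) (if c x == 0%N then q ^+ (b (wl x).-1).-1 else 0) +
  q ^+ (b n).-1.
Proof.
have /andP[q0 qh] := inv_card_le.
have q1 : q <= 1 by apply: le_trans qh _; rewrite invf_le1 // ler1n.
have term x : 0 <= (if c x == 0%N then q ^+ (b (wl x).-1).-1 else 0 : R).
  by case: ifP => // _; rewrite exprn_ge0.
have le r : (r <= n)%N -> (forall y, y \in F r -> c y != 0%N) ->
    \prod_(x <- F n) (if c x == 0%N then 1 else q) <= q ^+ (b r).-1.
  move=> rn cr; rewrite -size_punctured_ball; apply: prod_le_exp => //.
  - by rewrite filter_uniq // cball_uniq.
  - by rewrite filter_uniq // cball_uniq.
  - move=> x; rewrite !mem_filter => /andP[-> /=]; exact: cball_le.
  - by move=> x _; case: ifP; rewrite ?ler01 ?lexx // q0 q1.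
  by move=> x /cr /negPf ->.
have [allv|] := pselect (forall y, y \in F n -> c y != 0%N).
  by apply: ler_wpDl; [exact: sumr_ge0|exact: le].
move=> nall.
have exk : exists k, `[< exists2 x, x \in F n & c x = 0%N /\ wl x = k >].
  apply: contrapT => h; apply: nall => y yF; apply/eqP => cy.
  by apply: h; exists (wl y); apply/asboolP; exists y.
case: (ex_minnP exk) => k.
move=> /asboolP[x xF [cx xk]] kmin.
apply: ler_wpDr; first exact: exprn_ge0.
rewrite [leRHS](bigD1_seq x) ?filter_uniq ?cball_uniq //= cx eqxx.
apply: ler_wpDr; first by apply: sumr_ge0.
move: xF; rewrite mem_filter => /andP[x1 xn].
rewrite (mem_cball Ssym Sgen) in xn.
apply: le; first exact: leq_trans (leq_pred _) xn.
move=> y; rewrite mem_filter (mem_cball Ssym Sgen) => /andP[y1 yx].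
apply/eqP => cy.
have : (k <= wl y)%N.
  apply: kmin; apply/asboolP; exists y => //; rewrite mem_filter y1.
  by rewrite (mem_cball Ssym Sgen); apply: leq_trans yx _; apply: leq_trans xn; exact: leq_pred.
have : (0 < wl x)%N.
  rewrite lt0n; apply: contra x1 => /eqP x0.
  by have := mem_cball Ssym Sgen x 0; rewrite x0 inE => ->.
by rewrite -xk; clear m2; lia.
Qed.

Variable kap : R.
Hypothesis kap0 : 0 < kap.
Hypothesis superlinear : forall C, exists r0, forall r, (r0 <= r)%N -> (C * r < b r)%N.

(** Grouped by distance [r], the vertices and their factors grow at most exponentially, while the
    exponent of [q] is superlinear in [r]. *)
Lemma sum_visited_bounded : exists C : R, forall n,
  \sum_(x <- F n) (wl x)%:R / kap ^+ wl x * q ^+ (b (wl x).-1).-1 <= C.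
Proof.
have /andP[q0 qh] := inv_card_le.
pose T r : R := r%:R / kap ^+ r * q ^+ (b r.-1).-1.
have T0 r : 0 <= T r.
  by rewrite mulr_ge0 ?exprn_ge0 // divr_ge0 ?ler0n // exprn_ge0 // ltW.
have [C CP] : exists C, forall N, \sum_(r < N) (b r)%:R * T r <= C.
  (* Collects [r <= 2 ^ r], the ball bound [(size S).+1 ^ r] and [kap ^- r]. *)
  pose D : R := 2 * (size S).+1%:R / kap.
  have D0 : 0 <= D by rewrite divr_ge0 ?mulr_ge0 // ltW.
  have bT r : (b r)%:R * T r <= D ^+ r * q ^+ (b r.-1).-1.
    rewrite /T mulrA ler_wpM2r ?exprn_ge0 //.
    rewrite /D !exprMn exprVn mulrA ler_wpM2r ?invr_ge0 ?exprn_ge0 ?(ltW kap0) //.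
    rewrite mulrC -!natrX -!natrM ler_nat leq_mul ?size_cball //.
    exact/ltnW/ltn_expl.
  have [k Dk] : exists k, D <= 2 ^+ k.
    exists (Num.truncn D).+1; apply: le_trans (ltW (truncnS_gt D)) _.
    by rewrite -natrX ler_nat; exact/ltnW/ltn_expl.
  (* The factor 2 absorbs the shift to radius [r - 1] once [r >= 2], leaving exponent at least
     [(k + 1) * r] against [D ^+ r <= 2 ^+ (k * r)]. *)
  have [r0 r0P] := superlinear (2 * k.+1).
  apply: (@sum_eventually_geometric _ (fun r => (b r)%:R * T r) r0.+2).
    by move=> r; rewrite mulr_ge0 ?ler0n.
  move=> r rr; apply: le_trans (bT r) _.
  have br : (k.+1 * r <= (b r.-1).-1)%N.
    have := r0P r.-1; clear m2; case: r rr => // r; rewrite ltnS => rr /(_ (ltnW rr)).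
    by clear -rr; rewrite /=; nia.
  apply: (@le_trans _ _ ((2 ^+ k) ^+ r * 2^-1 ^+ (k.+1 * r))).
    apply: ler_pM; rewrite ?exprn_ge0 //.
      by rewrite lerXn2r // nnegrE ?exprn_ge0.
    apply: (@le_trans _ _ (2^-1 ^+ (b r.-1).-1)).
      by rewrite lerXn2r // nnegrE invr_ge0.
    by rewrite ler_wiXn2l // ?invr_ge0 // invf_le1 // ler1n.
  rewrite -exprM mulSn exprD [X in _ * X]mulrC mulrA -exprMn mulfV //.
  by rewrite expr1n mul1r.
exists C => n; apply: le_trans (CP n.+1).
apply: (@le_trans _ _ (\sum_(x <- cball S n) T (wl x))).
  by rewrite /F big_filter big_mkcond; apply: ler_sum => x _; case: ifP.
apply: (@le_trans _ _ (\sum_(x <- cball S n) \sum_(r < n.+1 | wl x == r) T r)).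
  rewrite big_seq [leRHS]big_seq; apply: ler_sum => x.
  rewrite (mem_cball Ssym Sgen) -ltnS => xn.
  by rewrite (big_pred1 (Ordinal xn)) // => i; rewrite eq_sym.
rewrite (exchange_big_dep xpredT) //=; apply: ler_sum => r _.
rewrite -big_filter big_const_seq count_predT iter_addr_0 -[leLHS]mulr_natl.
rewrite ler_wpM2r // ler_nat; apply: uniq_leq_size.
  by rewrite filter_uniq // cball_uniq.
move=> x; rewrite mem_filter => /andP[/eqP xr _].
by rewrite (mem_cball Ssym Sgen) xr.
Qed.

End FiniteLamps.

(** * Bounded expected number of returns in both cases *)

Theorem theorem1p5 (R : realType) (G H : groupType) (S : seq G)
  (mu : H -> R) (lam : R)
  (d : measure_display) (Om : measurableType d) (P : probability Om R)
  (Z : nat -> Om -> G) (U V : nat -> Om -> H) :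
  ~ finite_group G ->
  symmetric_set S -> generates (fun x => x \in S) ->
  nontrivial_group H -> finitely_generated H ->
  ((~ virtually_Z G /\ finite_group H /\ uniform_measure mu) \/
   (~ finite_group H /\ fin_supp_prob mu /\ symmetric_measure mu /\
      non_degenerate mu)) ->
  1 <= lam ->
  stationary_rw_law P S lam mu Z U V ->
  {ae P, forall w, exists N : nat, forall n : nat, (N <= n)%N ->
      ~ at_identity Z U V n w}.
Proof.
move=> Ginf Ssym Sgen [h0 h01] _ hyp lam1 law.
have S0 : S != [::].
  apply/negP => /eqP SE; apply: Ginf; exists [:: 1%g] => g.
  have [[|s w] [wS ->]] := Sgen g; first by rewrite inE.
  by have := wS s (mem_head _ _); rewrite SE !in_nil => -[].
have wlF (x : G) : x \in cball S (wlen Ssym Sgen x).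
  by rewrite (mem_cball Ssym Sgen).
case: hyp => [[nvZ [_ [A [uA [Aall muE]]]]]|[Hinf [[mu0 [B [uB [muB sB]]]] [mu_sym ndeg]]]].
  have m2 : (2 <= size A)%N.
    by apply: (@uniq_leq_size _ [:: h0; 1%g]) => //=; rewrite inE h01.
  have m0 : (size A)%:R != 0 :> R by rewrite pnatr_eq0 -lt0n; apply: leq_trans m2.
  have mu_gt0 s : s \in A -> 0 < mu s.
    by move=> _; rewrite muE invr_gt0 lt0r m0 ler0n.
  have mu_sum : \sum_(s <- A) mu s = 1.
    under eq_bigr do rewrite muE.
    by rewrite big_const_seq count_predT iter_addr_0 -[LHS]mulr_natl mulfV.
  have k0 := kappa_gt0 lam1 S0.
  have growth := superlinear_growth Ssym Sgen Ginf nvZ.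
  have [C CP] := sum_visited_bounded Ssym Sgen m2 k0 growth.
  have /andP[q0 qh] := inv_card_le R m2.
  apply: (@ae_transient _ _ _ _ _ _ S lam mu A Z U V law (C + 1)) => N.
  have [r0 r0P] := growth 1%N.
  (* The ball then has more than [N] elements, so the total error [N * e] is at most
     [2 ^+ N * 2^-1 ^+ N = 1], the summand 1 in [C + 1]. *)
  pose n := maxn r0 N; have nP := r0P n (leq_maxl _ _).
  set q := (size A)%:R^-1 in q0 qh CP.
  set F := [seq x <- cball S n | x != 1%g].
  set e := q ^+ (size (cball S n)).-1.
  have F1 : 1%g \notin F by rewrite mem_filter eqxx.
  have uF : uniq F by rewrite filter_uniq // cball_uniq.
  (* Only the level of no visits contributes, so the sum of [g x] over levels is a single term. *)
  pose g (x : G) (j : nat) : R := if j == 0%N then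
    q ^+ (size (cball S (wlen Ssym Sgen x).-1)).-1 else 0.
  apply: (le_trans (@sum_prob_returnE _ _ _ _ _ _ S lam mu A Z U V lam1 S0 uA
    mu_gt0 mu_sum law F g (wlen Ssym Sgen)
    (fun x => q ^+ (size (cball S (wlen Ssym Sgen x).-1)).-1) e N uF F1 _ _ _ _ _)) => //.
  - by move=> x j; rewrite /g; case: ifP => // _; exact: exprn_ge0.
  - move=> x [|M]; first by rewrite big_ord0 exprn_ge0.
    by rewrite big_ord_recl big1 ?addr0 /g //= => i _.
  - move=> c; under eq_bigr do rewrite (returnp_uniform uA Aall muE).
    exact: (prod_visited_le R Ssym Sgen m2).
  - exact: exprn_ge0.
  rewrite lee_fin; apply: lerD; first exact: CP.
  have Nb : (N <= (size (cball S n)).-1)%N by clear m2; lia.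
  apply: (@le_trans _ _ (2 ^+ N * 2^-1 ^+ N)); last first.
    by rewrite -exprMn mulfV // expr1n.
  apply: ler_pM => //; rewrite ?exprn_ge0 //.
    by rewrite -natrX ler_nat; exact/ltnW/ltn_expl.
  apply: (@le_trans _ _ (q ^+ N)).
    rewrite ler_wiXn2l //; apply: le_trans qh _.
    by rewrite invf_le1 // ler1n.
  by rewrite lerXn2r // nnegrE invr_ge0.
(* [B] may contain points of mass zero; [A] is exactly the support. *)
pose A := [seq h <- B | 0 < mu h].
have uA : uniq A by rewrite filter_uniq.
have AP h : (h \in A) = (0 < mu h).
  rewrite mem_filter andb_idr // => hp; apply: contraTT hp => /muB ->.
  by rewrite ltxx.
have Asym : symmetric_set A by move=> s; rewrite !AP mu_sym.
have mu_gt0 s : s \in A -> 0 < mu s by rewrite AP.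
have mu_sum : \sum_(s <- A) mu s = 1.
  rewrite /A big_filter -sB [RHS](bigID (fun h => 0 < mu h)) /= [X in _ + X]big1 ?addr0 //.
  by move=> h; rewrite -leNgt => hn; apply/eqP; rewrite eq_le hn mu0.
have Agen : generates (fun x => x \in A).
  move=> g; have [w [wA ->]] := ndeg g; exists w; split=> // x xw.
  by rewrite !AP; exact: wA.
have [C CP] := sum_returnp4 uA Asym mu_gt0 mu_sum mu_sym Agen Hinf.
(* Four lamps, since it is the fourth powers of [returnp] that are summable. *)
have [F [uF sF F1]] := infinite_group_uniq Ginf 4.
apply: (@ae_transient _ _ _ _ _ _ S lam mu A Z U V law
  (\sum_(x <- F) (wlen Ssym Sgen x)%:R / kappa S lam ^+ wlen Ssym Sgen x * C)) => N.
have a0 j : 0 <= returnp mu A j by exact: convp_ge0.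
apply: (le_trans (@sum_prob_returnE _ _ _ _ _ _ S lam mu A Z U V lam1 S0 uA
    mu_gt0 mu_sum law F (fun _ j => returnp mu A j ^+ 4) (wlen Ssym Sgen)
    (fun _ => C) 0 N uF F1 _ _ _ _ _)) => //.
- by move=> x j; exact: exprn_ge0.
- move=> c; rewrite addr0; move: sF; case: (F) => [//|x [//|y [//|z [//|t [|//]]]]] _.
  rewrite !big_cons !big_nil mulr1 addr0 !addrA; exact: prod4_le_sum.
by rewrite mulr0 addr0.
Qed.
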